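(* Let $(\theta,\alpha)$ and $(\theta,\beta)$ be two $(K,v)$-distinguished pairs such that $K(\theta)|K$ is unibranched, and let $\phi,\psi$ be the minimal polynomials of $\alpha,\beta$ over $K$ respectively. Then (i) $\Gamma_\alpha=\Gamma_\beta$, (ii) $k_\alpha=k_\beta$, (iii) $\bar v(\phi(\theta))=\bar v(\psi(\theta))$, and (iv) $d(K(\alpha)|K)=d(K(\beta)|K)$.
   Context: $(K,v)$ is a valued field of arbitrary rank, $\overline K$ a fixed algebraic closure, $\bar v$ a fixed extension of $v$ to $\overline K$. For $\alpha\in\overline K$: $\deg\alpha=[K(\alpha):K]$; $\Gamma_\alpha$ and $k_\alpha$ are the value group and residue field of the restriction of $\bar v$ to $K(\alpha)$ (residue fields are regarded as subfields of the residue field of $\bar v$). A finite extension $L|K$ is unibranched if $v$ has a unique extension $v_L$ to $L$; in that case $d(L|K)=[L^h:K^h]/(ef)$, where $e,f$ are the ramification index and inertia degree of $v_L|v$ and $L^h,K^h$ are Henselizations with respect to the extension of $v_L$ to $\overline K$. (In the situation of the theorem $K(\alpha)|K$ and $K(\beta)|K$ are also unibranched.) $(\theta,\alpha)\in\overline K^2$ is a $(K,v)$-distinguished pair if: $\deg\theta>\deg\alpha$; $\bar v(\theta-\alpha)=\max\{\bar v(\theta-\gamma):\gamma\in\overline K,\ \deg\gamma<\deg\theta\}$; and $\bar v(\theta-\eta)<\bar v(\theta-\alpha)$ for every $\eta\in\overline K$ with $\deg\eta<\deg\alpha$. *)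

(* Defs.v *)
From HB Require Import structures.
From mathcomp Require Import all_boot all_order all_algebra.
From mathcomp Require Import finmap boolp classical_sets functions cardinality.

Set Implicit Arguments.
Unset Strict Implicit.
Unset Printing Implicit Defensive.

Import Order.TTheory GRing.Theory Num.Theory.
Local Open Scope quotient_scope.
Local Open Scope classical_set_scope.
Local Open Scope ring_scope.

(* Totally ordered abelian groups. There is no Archimedean condition, hence
   valuations below have arbitrary rank. *)
HB.mixin Record isOrderedAbelianGroup G of Num.POrderedZmodule G := {
  oag_total : total (<=%R : rel G);
  oag_leD2l : forall z x y : G, x <= y -> z + x <= z + y
}.

#[short(type="oagType")]
HB.structure Definition OrderedAbelianGroup :=
  {G of Num.POrderedZmodule G & isOrderedAbelianGroup G}.

(* G with an additional greatest element [None], the value of 0. *)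
Definition with_oo (G : Type) : Type := option G.

Section WithInfinity.
Variable G : oagType.

HB.instance Definition _ := Choice.copy (with_oo G) (option G).

Definition oo_le (a b : with_oo G) : bool :=
  match a, b with
  | _, None => true
  | None, Some _ => false
  | Some x, Some y => x <= y
  end.

Definition oo_lt (a b : with_oo G) : bool := (b != a) && oo_le a b.

Fact oo_le_anti : antisymmetric oo_le.
Proof. by move=> [x|] [y|] //= /le_anti ->. Qed.

Fact oo_le_trans : transitive oo_le.
Proof. by move=> [x|] [y|] [z|] //=; apply: le_trans. Qed.

Fact oo_le_total : total oo_le.
Proof. by move=> [x|] [y|] //=; apply: oag_total. Qed.

HB.instance Definition _ := @Order.isOrder.Build ring_display (with_oo G)
  oo_le oo_lt
  (fun a b => if oo_lt a b then a else b)
  (fun a b => if oo_lt a b then b else a)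
  (fun _ _ => erefl) (fun _ _ => erefl) (fun _ _ => erefl)
  oo_le_anti oo_le_trans oo_le_total.

Definition oo_add (a b : with_oo G) : with_oo G :=
  if a is Some x then if b is Some y then Some (x + y) else None else None.

End WithInfinity.

(* [w] is a valuation on the subfield [E] of [L]; its values outside [E] are
   irrelevant, and it need not be onto [G]. *)
Definition valuation_on (L : fieldType) (G : oagType) (E : set L)
    (w : L -> with_oo G) : Prop :=
  [/\ forall x, E x -> (w x = None <-> x = 0),
      forall x y, E x -> E y -> w (x * y) = oo_add (w x) (w y)
    & forall x y, E x -> E y -> Order.min (w x) (w y) <= w (x + y)].

Record valuation (L : fieldType) (G : oagType) := Valuation {
  valuation_fun :> L -> with_oo G;
  valuationP : valuation_on setT valuation_fun
}.

Section ResidueField.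
Variables (L : fieldType) (G : oagType) (v : valuation L G).
Implicit Types x y : L.

Fact val_None x : v x = None <-> x = 0.
Proof. by case: (valuationP v) => h _ _; apply: h. Qed.

Fact valM x y : v (x * y) = oo_add (v x) (v y).
Proof. by case: (valuationP v) => _ h _; apply: h. Qed.

Fact valD x y : Order.min (v x) (v y) <= v (x + y).
Proof. by case: (valuationP v) => _ _ h; apply: h. Qed.

Fact val1 : v 1 = Some 0.
Proof.
have := valM 1 1; rewrite mulr1.
case E: (v 1) => [g|] /=; last by move/val_None/eqP: E; rewrite oner_eq0.
by case=> /esym/eqP; rewrite -subr_eq0 addrK => /eqP ->.
Qed.

Fact valN1 : v (-1) = Some 0.
Proof.
have := valM (-1) (-1); rewrite mulrNN mulr1 val1.
case: (v (-1)) => [g|] //= [] h; congr Some; apply/le_anti.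
by case/orP: (oag_total 0 g) => g0; have := oag_leD2l g _ _ g0;
  rewrite addr0 -h g0 => ->.
Qed.

Fact valN x : v (- x) = v x.
Proof. by rewrite -mulN1r valM valN1; case: (v x) => //= g; rewrite add0r. Qed.

Definition valring_pred : pred L := fun x => (Some 0 : with_oo G) <= v x.

Fact valring_subring : subring_closed valring_pred.
Proof.
split.
- by rewrite /in_mem /= /valring_pred val1.
- move=> x y hx hy; apply: le_trans (valD _ _).
  by rewrite valN le_min; apply/andP.
move=> x y; rewrite /in_mem /= /valring_pred valM.
case: (v x) => [a|] //; case: (v y) => [b|] //= ha hb.
by apply: le_trans (ha : 0 <= a) _; have := oag_leD2l a _ _ hb; rewrite addr0.
Qed.

HB.instance Definition _ :=
  GRing.isSubringClosed.Build L valring_pred valring_subring.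

Record valring := ValRing {
  valring_val : L;
  valringP : valring_pred valring_val
}.

HB.instance Definition _ := [isSub for valring_val].
HB.instance Definition _ := [Choice of valring by <:].
HB.instance Definition _ := [SubChoice_isSubComNzRing of valring by <:].

Definition max_ideal : pred valring :=
  fun u => (Some 0 : with_oo G) < v (val u).

Fact val_unit x : (Some 0 : with_oo G) <= v x ->
  ~~ ((Some 0 : with_oo G) < v x) -> v x = Some 0.
Proof. by move=> h; rewrite -leNgt => h'; apply/le_anti; rewrite h h'. Qed.

Fact max_ideal_closed : idealr_closed max_ideal.
Proof.
split.
- by rewrite /in_mem /= /max_ideal raddf0 (iffRL (val_None 0)).
- by rewrite /in_mem /= /max_ideal rmorph1 val1 ltxx.
move=> a u w hu hw; rewrite /in_mem /= /max_ideal rmorphD rmorphM.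
apply: lt_le_trans (valD _ _); rewrite lt_min; apply/andP; split => //.
move: hu; rewrite /in_mem /= /max_ideal valM.
case: a => a /=; rewrite /valring_pred.
case: (v a) => [p|] //; case: (v (val u)) => [q|] //= hp hq.
have hp' : 0 <= p := hp.
apply: lt_le_trans hq _; change (q <= p + q).
by have := oag_leD2l q _ _ hp'; rewrite addr0 addrC.
Qed.

HB.instance Definition _ := isIdealr.Build valring max_ideal max_ideal_closed.

Definition residue_ideal : idealr valring := max_ideal.

Definition residue_field : Type := {ideal_quot residue_ideal}.

HB.instance Definition _ := GRing.ComNzRing.on residue_field.
HB.instance Definition _ := EqQuotient.on residue_field.

Definition residue (x : valring) : residue_field := \pi x.

HB.instance Definition _ :=
  GRing.RMorphism.copy residue \pi_{ideal_quot residue_ideal}.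

Fact residue_eq0 (x : valring) :
  (residue x == 0) = ((Some 0 : with_oo G) < v (val x)).
Proof.
rewrite -[RHS]/(x \in residue_ideal) -[x in RHS]subr0.
by rewrite (Quotient.idealrBE residue_ideal) -[\pi 0]/(residue 0) rmorph0.
Qed.

Fact valring_inv (x : valring) : residue x != 0 -> valring_pred (val x)^-1.
Proof.
rewrite residue_eq0 => /(val_unit (valringP x)) hx.
have x0 : val x != 0 by apply/eqP => /val_None; rewrite hx.
have := valM (val x) (val x)^-1; rewrite divff // val1 hx /valring_pred.
by case: (v _^-1) => [g|] //= []; rewrite add0r => <-.
Qed.

Definition residue_inv (q : residue_field) : residue_field :=
  if insub (val (repr q))^-1 is Some y then if q == 0 then 0 else residue y
  else 0.

Fact residue_mulVf (q : residue_field) : q != 0 -> residue_inv q * q = 1.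
Proof.
move=> q0; rewrite /residue_inv (negPf q0).
have hq : residue (repr q) = q by exact: reprK.
have hr : residue (repr q) != 0 by rewrite hq.
rewrite (insubT valring_pred (valring_inv hr)).
rewrite -[X in _ * X]hq -rmorphM -[RHS](rmorph1 residue).
congr (residue _); apply: val_inj; rewrite rmorphM rmorph1 /= mulVf //.
apply/eqP => h; move: hr; rewrite residue_eq0.
by rewrite (iffRL (val_None _)).
Qed.

Fact residue_inv0 : residue_inv 0 = 0.
Proof. by rewrite /residue_inv eqxx; case: insub. Qed.

HB.instance Definition _ :=
  GRing.ComNzRing_isField.Build residue_field residue_mulVf residue_inv0.

End ResidueField.

(* [E] is meant to be a subfield of [L]; [F] is a subfield of [E]. *)
Section Subfields.
Variable L : fieldType.
Implicit Types E F : set L.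

Definition is_subfield E : Prop := GRing.divring_closed (mem E).

Definition adjoin F (a : L) : set L := smallest is_subfield (F `|` [set a]).

Definition is_basis F E (n : nat) (b : 'I_n -> L) : Prop :=
  [/\ forall i, E (b i),
      forall c : 'I_n -> L, (forall i, F (c i)) ->
        \sum_(i < n) c i * b i = 0 -> forall i, c i = 0
    & forall x, E x ->
        exists2 c : 'I_n -> L, forall i, F (c i) & x = \sum_(i < n) c i * b i].

(* [E : F], with the convention that it is 0 when infinite. *)
Definition degree F E : nat :=
  xget 0%N [set n | exists b : 'I_n -> L, is_basis F E b].

End Subfields.

(* (A : B), with the convention that it is 0 when infinite. *)
Definition subgroup_index (G : zmodType) (B A : set G) : nat :=
  #|` fset_set [set [set a + b | b in B] | a in A]|.

(* Equivalence on [E] of valuations with possibly different value groups. *)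
Definition valuation_equiv (L : fieldType) (G G' : oagType) (E : set L)
    (w : L -> with_oo G) (w' : L -> with_oo G') : Prop :=
  forall x y, E x -> E y -> (w x <= w y) = (w' x <= w' y).

Section ValuedSubfields.
Variables (L : fieldType) (G : oagType) (v : valuation L G).
Implicit Types E F : set L.

Definition value_group E : set G := [set g | exists2 x, E x & v x = Some g].

Definition residue_subfield E : set (residue_field v) :=
  [set residue x | x in [set x : valring v | E (val x)]].

(* [v] itself restricts to an extension to [E] of the restriction of [v] to
   [F], so only uniqueness, up to equivalence, is at stake. *)
Definition unibranched F E : Prop :=
  forall (G' : oagType) (w : L -> with_oo G'),
    valuation_on E w -> valuation_equiv F w v -> valuation_equiv E w v.

(* When [L] is an algebraic closure of [E]. *)
Definition henselian E : Prop := is_subfield E /\ unibranched E setT.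

(* The least henselian field between [F] and its algebraic closure [L]. *)
Definition henselization F : set L := smallest henselian F.

Definition ramification_index F E : nat :=
  subgroup_index (value_group F) (value_group E).

Definition inertia_degree F E : nat :=
  degree (residue_subfield F) (residue_subfield E).

Definition defect F E : rat :=
  (degree (henselization F) (henselization E))%:R
    / (ramification_index F E * inertia_degree F E)%:R.

End ValuedSubfields.

Arguments residue_subfield {L G} v E.

Section DistinguishedPairs.
Variables (K Kbar : fieldType) (iota : {rmorphism K -> Kbar}).
Variables (G : oagType) (vbar : valuation Kbar G).

(* [iota] identifies [K] with its image [range iota] in [Kbar]. *)
Definition simple_ext (a : Kbar) : set Kbar := adjoin (range iota) a.

Definition deg (a : Kbar) : nat := degree (range iota) (simple_ext a).

Definition is_maximum (A : set (with_oo G)) (m : with_oo G) : Prop :=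
  A m /\ ubound A m.

Definition distinguished_pair (theta alpha : Kbar) : Prop :=
  [/\ (deg alpha < deg theta)%N,
      is_maximum
        [set vbar (theta - gamma) | gamma in [set c | (deg c < deg theta)%N]]
        (vbar (theta - alpha))
    & forall eta, (deg eta < deg alpha)%N ->
        vbar (theta - eta) < vbar (theta - alpha)].

Definition is_minpoly (a : Kbar) (p : {poly K}) : Prop :=
  [/\ p \is monic, root (map_poly iota p) a
    & forall q, q != 0 -> root (map_poly iota q) a -> (size p <= size q)%N].

End DistinguishedPairs.

(* Main.v *)
(* Put delta = v(theta - alpha) = v(theta - beta) and n = deg alpha = deg beta.
   If f in K[X] has degree < n, its roots lie outside the ball of radius delta
   around theta, so f(alpha), f(beta) and f(theta) agree up to factors in 1 + m,
   m being the maximal ideal. As K(alpha) consists of such f(alpha), this gives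
   (i) and (ii); (iii) follows on applying it to f = phi - psi.

   For (iv) there remain the degrees of alpha and beta over the henselization
   K^h, which is found inside the fixed field of the decomposition group D. The
   roots of the minimal polynomial of alpha over K^h form a D-orbit, and D
   permutes the balls of radius delta, so it is enough to count roots in the
   ball around theta. A root x of phi in this ball yields a value-preserving
   isomorphism from K(alpha) to K(x), which extends to an element of D; since
   K^h is separable over K, phi and the minimal polynomial over K^h have the
   same roots there, with the same multiplicities. Finally phi(theta + d X) and
   psi(theta + d X), v(d) = delta, are suitably scaled congruent modulo m up to a
   constant, so phi and psi have equally many roots in the ball. *)

Require Import Defs.
From HB Require Import structures.
From mathcomp Require Import all_boot all_order all_algebra.
From mathcomp Require Import ring separable.
From mathcomp Require Import finmap boolp classical_sets functions cardinality.

Set Implicit Arguments.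
Unset Strict Implicit.
Unset Printing Implicit Defensive.

Import Order.TTheory GRing.Theory Num.Theory.
Local Open Scope classical_set_scope.
Local Open Scope ring_scope.

(** * Subfields, minimal polynomials and simple extensions *)

(** The near-equality of f(alpha) and f(beta) rests on degrees over K, and nothing comparable is
    given over K^h; this forces the detour through root counts, in which only the action of D and
    multiplicities have to be carried from K to K^h. Two obstacles shape the preparation. The
    henselization is an intersection of henselian fields, so its being henselian is itself a claim:
    each henselian field over K contains a power of every element of the fixed field of D, and the
    exponent can be chosen from the degree over K alone, so it survives the intersection. In
    characteristic p the fixed field of D contains everything purely inseparable over K, so it
    cannot control multiplicities; it must be shown separately that an element separable over K^h is
    separable over K. Homs between subfields are encoded as fields inside the product of source and
    target: extending a hom becomes enlarging a set of pairs, and Zorn's lemma applies directly. The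
    value-preserving extension is built one element at a time, by picking a conjugate that keeps
    integral elements integral. *)

Section SubfieldType.
Variables (R : comUnitRingType) (A : set R).

(** Stated over a ring with units because it is also applied to subsets of L * M. In such a product
    non-zero elements need not be invertible, hence the second clause. *)
Definition field_set : Prop :=
  GRing.divring_closed (mem A) /\ forall x, A x -> x != 0 -> x \is a GRing.unit.

Definition field_pred of field_set : pred R := fun x => x \in A.

Hypothesis fA : field_set.

Fact field_pred_divring : GRing.divring_closed (field_pred fA).
Proof. by have [[h1 h2 h3] _] := fA; split. Qed.

HB.instance Definition _ :=
  GRing.isDivringClosed.Build R (field_pred fA) field_pred_divring.

Record subfieldType := SubfieldType {
  subfield_val : R;
  subfield_valP : field_pred fA subfield_val
}.

HB.instance Definition _ := [isSub for subfield_val].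
HB.instance Definition _ := [Choice of subfieldType by <:].
HB.instance Definition _ := [SubChoice_isSubComNzRing of subfieldType by <:].

Fact subfield_inv_subproof (x : subfieldType) : field_pred fA (val x)^-1.
Proof.
have h : val x \in field_pred fA by exact: subfield_valP.
rewrite -[field_pred _ _]/((val x)^-1 \in field_pred fA).
by rewrite rpredVr.
Qed.

Definition subfield_inv x := SubfieldType (subfield_inv_subproof x).

Fact subfield_mulVf x : x != 0 -> subfield_inv x * x = 1.
Proof.
move=> x0; apply: val_inj; rewrite rmorphM rmorph1 /= mulVr //.
have [_] := fA; apply; first by have := subfield_valP x; rewrite /field_pred inE.
by rewrite -(rmorph0 (val : {rmorphism subfieldType -> R})) (inj_eq val_inj).
Qed.

Fact subfield_inv0 : subfield_inv 0 = 0.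
Proof. by apply: val_inj; rewrite /= invr0. Qed.

HB.instance Definition _ :=
  GRing.ComNzRing_isField.Build subfieldType subfield_mulVf subfield_inv0.

HB.instance Definition _ := GRing.RMorphism.copy subfield_val
  (val : {rmorphism subfieldType -> R}).

Lemma mem_subfield_val (x : subfieldType) : A (subfield_val x).
Proof. by have := subfield_valP x; rewrite /field_pred inE. Qed.

Lemma range_subfield_val : range subfield_val = A.
Proof.
apply/seteqP; split => [_ [x _ <-]|x Ax]; first exact: mem_subfield_val.
have hx : field_pred fA x by rewrite /field_pred inE.
by exists (SubfieldType hx).
Qed.
End SubfieldType.

Arguments subfield_val {R A fA}.

Lemma subfield_field_set (L : fieldType) (E : set L) :
  is_subfield E -> field_set E.
Proof. by move=> sE; split=> // x _; rewrite unitfE. Qed.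
Section SubfieldClosure.
Variables (L : fieldType) (E : set L).
Hypothesis sE : is_subfield E.
Implicit Types x y : L.

Lemma subfield1 : E 1.
Proof. by case: sE => h _ _; have := h; rewrite inE. Qed.

Lemma subfieldB x y : E x -> E y -> E (x - y).
Proof. by case: sE => _ h _ Ex Ey; have := h x y; rewrite !inE; apply. Qed.

Lemma subfield_div x y : E x -> E y -> E (x / y).
Proof. by case: sE => _ _ h Ex Ey; have := h x y; rewrite !inE; apply. Qed.

Lemma subfield0 : E 0.
Proof. by rewrite -(subrr 1); apply: subfieldB; apply: subfield1. Qed.

Lemma subfieldN x : E x -> E (- x).
Proof. by rewrite -sub0r; apply: subfieldB; apply: subfield0. Qed.

Lemma subfieldD x y : E x -> E y -> E (x + y).
Proof. by move=> Ex Ey; rewrite -(opprK y); apply/subfieldB/subfieldN. Qed.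

Lemma subfieldV x : E x -> E x^-1.
Proof. by rewrite -div1r; apply: subfield_div; apply: subfield1. Qed.

Lemma subfieldM x y : E x -> E y -> E (x * y).
Proof. by move=> Ex Ey; rewrite -(invrK y); apply/subfield_div/subfieldV. Qed.

Lemma subfieldX x n : E x -> E (x ^+ n).
Proof.
move=> Ex; elim: n => [|n IH]; first by rewrite expr0; apply: subfield1.
by rewrite exprS; apply: subfieldM.
Qed.

Lemma subfield_sum (I : Type) (r : seq I) (P : pred I) (f : I -> L) :
  (forall i, P i -> E (f i)) -> E (\sum_(i <- r | P i) f i).
Proof.
by move=> h; elim/big_ind : _ => //; [apply: subfield0|apply: subfieldD].
Qed.

Lemma subfield_horner (q : {poly L}) x :
  (forall i, E q`_i) -> E x -> E q.[x].
Proof.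
move=> hq Ex; rewrite horner_coef; apply: subfield_sum => i _.
by apply: subfieldM => //; apply: subfieldX.
Qed.

End SubfieldClosure.

Lemma subfield_range (F L : fieldType) (iota : {rmorphism F -> L}) :
  is_subfield (range iota).
Proof.
split; rewrite ?inE; first by exists 1; rewrite ?rmorph1.
  move=> x y; rewrite !inE => -[a _ <-] [b _ <-].
  by exists (a - b); rewrite ?rmorphB.
move=> x y; rewrite !inE => -[a _ <-] [b _ <-].
by exists (a / b); rewrite ?fmorph_div.
Qed.

Lemma subfield_smallest (L : fieldType) (C : set L -> Prop) (G : set L) :
  (forall E, C E -> is_subfield E) -> is_subfield (smallest C G).
Proof.
move=> h; split; rewrite ?inE.
- by move=> E [/h sE _]; apply: subfield1.
- move=> x y; rewrite !inE => hx hy E [CE GE].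
  by apply: (subfieldB (h _ CE)); [apply: hx|apply: hy].
- move=> x y; rewrite !inE => hx hy E [CE GE].
  by apply: (subfield_div (h _ CE)); [apply: hx|apply: hy].
Qed.

Section Adjoin.
Variables (L : fieldType).
Implicit Types (E M : set L) (a : L).

Lemma adjoin_subfield E a : is_subfield (adjoin E a).
Proof. exact: subfield_smallest. Qed.

Lemma sub_adjoin E a : E `<=` adjoin E a.
Proof. by move=> x Ex M [_]; apply; left. Qed.

Lemma mem_adjoin E a : adjoin E a a.
Proof. by move=> M [_]; apply; right. Qed.

Lemma adjoin_sub E M a : is_subfield M -> E `<=` M -> M a -> adjoin E a `<=` M.
Proof. by move=> sM EM Ma; apply: smallest_sub => // x [/EM//|->]. Qed.

End Adjoin.

Section MinimalPolynomial.
Variables (F L : fieldType) (iota : {rmorphism F -> L}).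
Implicit Types (p q r : {poly F}) (a : L).

Lemma poly_lift (q : {poly L}) : (forall i, range iota q`_i) ->
  exists q0 : {poly F}, map_poly iota q0 = q.
Proof.
move=> h; have /choice[f hf] : forall i, exists x, iota x = q`_i.
  by move=> i; have [x _ <-] := h i; exists x.
exists (\poly_(i < size q) f i); apply/polyP => i.
rewrite coef_map coef_poly; case: ltnP => [_|/(nth_default 0) ->]; first exact: hf.
exact: rmorph0.
Qed.

Lemma exists_minpoly a : algebraicOver iota a -> exists p, is_minpoly iota a p.
Proof.
case=> q0 q0N0 rq0.
pose P n := `[< exists q, [/\ q != 0, root (map_poly iota q) a & size q = n] >].
have exP : exists n, P n by exists (size q0); apply/asboolP; exists q0.
case: (ex_minnP exP) => n /asboolP[q [qN0 rq sq]] minn.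
have cN0 : (lead_coef q)^-1 != 0 by rewrite invr_eq0 lead_coef_eq0.
exists ((lead_coef q)^-1 *: q); split.
- by rewrite monicE lead_coefZ mulVf // lead_coef_eq0.
- by rewrite map_polyZ rootZ // fmorph_eq0.
- move=> r rN0 rr; rewrite size_scale // sq; apply: minn.
  by apply/asboolP; exists r.
Qed.

Variables (a : L) (p : {poly F}).
Hypothesis pmin : is_minpoly iota a p.

Lemma minpoly_neq0 : p != 0.
Proof. by case: pmin => /monic_neq0. Qed.

Lemma minpoly_dvd q : root (map_poly iota q) a = (p %| q).
Proof.
have [_ rp min_p] := pmin; apply/idP/idP => [rq|/dvdpP[r ->]]; last first.
  by rewrite rmorphM rootM rp orbT.
rewrite /dvdp; apply: contraT => mN0.
have /(min_p _ mN0) : root (map_poly iota (q %% p)) a.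
  move: rq; rewrite {1}(divp_eq q p) rmorphD rmorphM /root hornerD hornerM.
  by rewrite (rootP rp) mulr0 add0r.
by rewrite leqNgt ltn_modp minpoly_neq0.
Qed.

Lemma minpoly_size_gt1 : (1 < size p)%N.
Proof.
have [_ rp _] := pmin; rewrite ltnNge; apply/negP => /size1_polyC pC.
have := rp; rewrite pC map_polyC rootC fmorph_eq0 => /eqP c0.
by have := minpoly_neq0; rewrite pC c0 eqxx.
Qed.

(** Write p as r times the gcd. If [a] were a root of the gcd, p would divide q; so it is a root of
    r, and minimality of p leaves only size 1 for the gcd. *)
Lemma minpoly_coprime q : ~~ (p %| q) -> coprimep p q.
Proof.
move=> pNq; rewrite coprimep_def.
have gp := dvdp_gcdl p q; have gq := dvdp_gcdr p q.
have gN0 : gcdp p q != 0 by rewrite gcdp_eq0 negb_and minpoly_neq0.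
have /dvdpP[r pE] := gp.
have rN0 : r != 0 by apply: contraTneq minpoly_neq0 => r0; rewrite pE r0 mul0r eqxx.
have : root (map_poly iota p) a by case: pmin.
rewrite {1}pE rmorphM rootM !minpoly_dvd => /orP[pr|pg]; last first.
  by case/negP: pNq; apply: dvdp_trans pg gq.
have := dvdp_leq rN0 pr; rewrite {1}pE size_mul // => sr.
have gs : (0 < size (gcdp p q))%N by rewrite lt0n size_poly_eq0.
rewrite eqn_leq gs andbT -(leq_add2l (size r)) addn1.
exact: leq_trans (leqSpred _) _.
Qed.

(* A hom out of F(a) is determined by sending [a] to any root of the image of
   its minimal polynomial. *)
Lemma minpoly_root_transfer (M : fieldType) (j : {rmorphism F -> M}) (b : M) q :
  root (map_poly j p) b -> root (map_poly j q) b = root (map_poly iota q) a.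
Proof.
move=> rb; rewrite minpoly_dvd; apply/idP/idP; last first.
  by case/dvdpP => r ->; rewrite rmorphM rootM rb orbT.
move=> rq; apply: contraT => /minpoly_coprime/Bezout_eq1_coprimepP[[u w] /= e].
have /(congr1 (fun r => (map_poly j r).[b])) := e.
rewrite rmorphD !rmorphM /= hornerD !hornerM (rootP rb) (rootP rq) !mulr0 addr0.
by rewrite rmorph1 hornerC => /eqP; rewrite eq_sym oner_eq0.
Qed.

Lemma minpoly_of_root b : root (map_poly iota p) b -> is_minpoly iota b p.
Proof.
by move=> rb; case: pmin => pm rp min_p; split=> // q qN0;
  rewrite (minpoly_root_transfer _ rb); apply: min_p.
Qed.

Lemma horner_inv q : ~~ root (map_poly iota q) a ->
  exists u, (map_poly iota u).[a] = ((map_poly iota q).[a])^-1.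
Proof.
rewrite minpoly_dvd => /minpoly_coprime/Bezout_eq1_coprimepP[[u w] /= e].
exists w; have /(congr1 (fun r => (map_poly iota r).[a])) := e.
have rp : root (map_poly iota p) a by case: pmin.
rewrite rmorphD !rmorphM /= hornerD !hornerM (rootP rp) mulr0 add0r.
rewrite rmorph1 hornerC => wq; apply: (mulIf (x := (map_poly iota q).[a])).
  by apply/eqP => q0; move: wq; rewrite q0 mulr0 => /esym/eqP; rewrite oner_eq0.
rewrite wq mulVf //; apply/eqP => q0; move: wq.
by rewrite q0 mulr0 => /esym/eqP; rewrite oner_eq0.
Qed.

End MinimalPolynomial.

Section AdjoinPolynomial.
Variables (F L : fieldType) (iota : {rmorphism F -> L}).
Variables (a : L) (p : {poly F}).
Hypothesis pmin : is_minpoly iota a p.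

Lemma adjoin_horner q : adjoin (range iota) a (map_poly iota q).[a].
Proof.
apply: (subfield_horner (adjoin_subfield _ _)); last exact: mem_adjoin.
by move=> i; rewrite coef_map; apply: sub_adjoin; exists q`_i.
Qed.

Lemma adjoin_poly x : adjoin (range iota) a x ->
  exists2 q : {poly F}, (size q < size p)%N & x = (map_poly iota q).[a].
Proof.
have rp : root (map_poly iota p) a by case: pmin.
pose S := [set (map_poly iota q).[a] | q in [set: {poly F}]].
have sS : is_subfield S.
  split; rewrite ?inE.
  - by exists 1 => //; rewrite rmorph1 hornerC.
  - move=> u w; rewrite !inE => -[q _ <-] [r _ <-].
    by exists (q - r) => //; rewrite rmorphB !hornerE.
  - move=> u w; rewrite !inE => -[q _ <-] [r _ <-].
    have [r0|/(horner_inv pmin)[s <-]] := boolP (root (map_poly iota r) a).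
      by exists 0 => //; rewrite (rootP r0) invr0 mulr0 rmorph0 horner0.
    by exists (q * s) => //; rewrite rmorphM hornerM.
have Fs : range iota `<=` S.
  by move=> _ [c _ <-]; exists c%:P => //; rewrite map_polyC hornerC.
have Sa : S a by exists 'X => //; rewrite map_polyX hornerX.
move=> /(adjoin_sub sS Fs Sa)[q _ <-]; exists (q %% p).
  by rewrite ltn_modp (minpoly_neq0 pmin).
rewrite {1}(divp_eq q p) rmorphD rmorphM hornerD hornerM.
by rewrite (rootP rp) mulr0 add0r.
Qed.

Lemma minpoly_small_neq0 (q : {poly F}) : q != 0 -> (size q < size p)%N ->
  ~~ root (map_poly iota q) a.
Proof.
by move=> qN0; apply: contraL => rq; rewrite -leqNgt; case: pmin => _ _; apply.
Qed.

End AdjoinPolynomial.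

(** The matrices expressing each basis in the other have product 1, by freeness of [b], and such a
    product bounds m by n. *)
Lemma is_basis_size_le (L : fieldType) (F E : set L) m n
    (b : 'I_m -> L) (c : 'I_n -> L) :
  is_subfield F -> is_basis F E b -> is_basis F E c -> (m <= n)%N.
Proof.
move=> sF [Eb freeb spanb] [Ec _ spanc].
have /choice[B hB] : forall i : 'I_m, exists u : 'I_n -> L,
    (forall j, F (u j)) /\ b i = \sum_j u j * c j.
  by move=> i; have [u Fu ->] := spanc _ (Eb i); exists u.
have /choice[C hC] : forall j : 'I_n, exists u : 'I_m -> L,
    (forall i, F (u i)) /\ c j = \sum_i u i * b i.
  by move=> j; have [u Fu ->] := spanb _ (Ec j); exists u.
apply: (@mulmx1_min _ _ _ (\matrix_(i, j) B i j) (\matrix_(j, i) C j i)).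
apply/matrixP => i k; rewrite !mxE.
under eq_bigr do rewrite !mxE.
pose d k := \sum_j B i j * C j k - (i == k)%:R.
suff : d k = 0 by move/eqP; rewrite subr_eq0 => /eqP.
apply: freeb k => [k|].
  apply: (subfieldB sF).
    apply: (subfield_sum sF) => j _; apply: (subfieldM sF).
      by have [] := hB i.
    by have [] := hC j.
  by case: eqP => _; [apply: subfield1|apply: subfield0].
under eq_bigr do rewrite mulrBl.
rewrite big_split /= sumrN; apply/eqP; rewrite subr_eq0; apply/eqP.
rewrite [RHS](bigD1 i) //= eqxx mul1r [X in _ = _ + X]big1 => [|l li]; last first.
  by rewrite eq_sym (negPf li) mul0r.
rewrite addr0.
have [_ ->] := hB i.
under eq_bigr do rewrite mulr_suml.
rewrite exchange_big /=; apply: eq_bigr => j _.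
have [_ eC] := hC j; rewrite [X in _ = _ * X]eC mulr_sumr.
by apply: eq_bigr => l _; rewrite mulrA.
Qed.

Lemma degreeE (L : fieldType) (F E : set L) n (b : 'I_n -> L) :
  is_subfield F -> is_basis F E b -> degree F E = n.
Proof.
move=> sF bE; apply: xget_unique; first by exists b.
move=> m [c cE]; apply/eqP; rewrite eqn_leq.
by rewrite (is_basis_size_le sF bE cE) (is_basis_size_le sF cE bE).
Qed.

Lemma degree_adjoin (F L : fieldType) (iota : {rmorphism F -> L}) a p :
  is_minpoly iota a p ->
  degree (range iota) (adjoin (range iota) a) = (size p).-1.
Proof.
move=> pmin; have rp : root (map_poly iota p) a by case: pmin.
have sp : (size p).-1.+1 = size p by rewrite prednK // (ltnW (minpoly_size_gt1 pmin)).
apply: (@degreeE _ _ _ _ (fun i : 'I_(size p).-1 => a ^+ i)).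
  exact: subfield_range.
split=> [i|c Fc|x /(adjoin_poly pmin)[q sq ->]].
- by apply: (subfieldX (adjoin_subfield _ _)); apply: mem_adjoin.
- have /choice[d hd] : forall i, exists x, iota x = c i.
    by move=> i; have [x _ <-] := Fc i; exists x.
  pose q : {poly F} := \sum_(i < (size p).-1) d i *: 'X^i.
  have qE : (map_poly iota q).[a] = \sum_(i < (size p).-1) c i * a ^+ i.
    rewrite rmorph_sum horner_sum; apply: eq_bigr => i _ /=.
    by rewrite map_polyZ map_polyXn hornerZ hornerXn /= hd.
  move=> sum0; have q0 : q = 0.
    apply/eqP; apply: contraT => qN0.
    have : (size q < size p)%N.
      rewrite -sp ltnS; apply: leq_trans (size_sum _ _ _) _.
      apply/bigmax_leqP => i _; apply: leq_trans (size_scale_leq _ _) _.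
      by rewrite size_polyXn.
    by move/(minpoly_small_neq0 pmin qN0); rewrite /root qE sum0 eqxx.
  move=> i; have /(congr1 (fun r : {poly F} => r`_i)) := q0.
  rewrite coef0 /q coef_sum (bigD1 i) //= coefZ coefXn eqxx mulr1 big1 ?addr0.
    by move=> d0; rewrite -hd d0 rmorph0.
  by move=> j ji; rewrite coefZ coefXn eq_sym (inj_eq val_inj) (negPf ji) mulr0.
- exists (fun i : 'I_(size p).-1 => iota q`_i); first by move=> i; exists q`_i.
  rewrite (@horner_coef_wide _ (size p).-1) ?size_map_poly -1?ltnS ?sp //.
  by apply: eq_bigr => i _; rewrite coef_map.
Qed.
(** * Valuations *)

Section OrderedGroup.
Variable G : oagType.
Implicit Types x y z : G.

Lemma oag_le_addl x z : (z <= z + x) = (0 <= x).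
Proof.
apply/idP/idP => [|x0]; last by have := oag_leD2l z _ _ x0; rewrite addr0.
by move/(oag_leD2l (- z)); rewrite addNr addrA addNr add0r.
Qed.

End OrderedGroup.

Section Valuation.
Variables (L : fieldType) (G : oagType) (v : valuation L G).
Implicit Types x y z : L.

(** Valuations are handled through their ring and maximal ideal rather than through values: these
    can be compared between valuations with different value groups. *)
Definition vring x : bool := (Some 0 : with_oo G) <= v x.
Definition vmax x : bool := (Some 0 : with_oo G) < v x.

Lemma val0 : v 0 = None.
Proof. exact/val_None. Qed.

Lemma val_le0 x : v x <= v 0.
Proof. by rewrite val0; case: (v x). Qed.

Lemma val_le_None (g : with_oo G) : g <= None.
Proof. by case: g. Qed.

Lemma val_lt0 x : (v x < v 0) = (x != 0).
Proof.
rewrite lt_neqAle val_le0 andbT val0; congr (~~ _).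
by apply/eqP/eqP => [/val_None//|->]; rewrite val0.
Qed.

Lemma vring0 : vring 0. Proof. by rewrite /vring val0. Qed.
Lemma vring1 : vring 1. Proof. by rewrite /vring Defs.val1. Qed.
Lemma vmax0 : vmax 0. Proof. by rewrite /vmax val0. Qed.
Lemma vmax1 : vmax 1 = false. Proof. by rewrite /vmax Defs.val1 ltxx. Qed.

Lemma vringN x : vring (- x) = vring x. Proof. by rewrite /vring Defs.valN. Qed.

Lemma vringD x y : vring x -> vring y -> vring (x + y).
Proof.
by move=> hx hy; apply: le_trans (Defs.valD v _ _); rewrite le_min; apply/andP.
Qed.

Lemma vringB x y : vring x -> vring y -> vring (x - y).
Proof. by move=> hx hy; apply: vringD => //; rewrite vringN. Qed.

Lemma vringM x y : vring x -> vring y -> vring (x * y).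
Proof.
by have [_ _ h] := valring_subring v; move=> hx hy; apply: (h x y).
Qed.

Lemma vringX x n : vring x -> vring (x ^+ n).
Proof.
by move=> hx; elim: n => [|n IH]; rewrite ?expr0 ?vring1 // exprS vringM.
Qed.

Lemma vmaxW x : vmax x -> vring x. Proof. exact: ltW. Qed.

Lemma vmaxN x : vmax (- x) = vmax x. Proof. by rewrite /vmax Defs.valN. Qed.

Lemma vmaxD x y : vmax x -> vmax y -> vmax (x + y).
Proof.
move=> hx hy; apply: lt_le_trans (Defs.valD v _ _).
by rewrite lt_min; apply/andP.
Qed.

Lemma vmaxB x y : vmax x -> vmax y -> vmax (x - y).
Proof. by move=> hx hy; apply: vmaxD => //; rewrite vmaxN. Qed.

Lemma val_le_div x y : x != 0 -> (v x <= v y) = vring (y / x).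
Proof.
move=> x0; rewrite -{1}(divfK x0 y) mulrC Defs.valM /vring.
have := val_lt0 x; rewrite x0 val0; case: (v x) => [a|//] _.
by case: (v _) => [c|] //=; apply: oag_le_addl.
Qed.

Lemma val_lt_div x y : x != 0 -> (v x < v y) = vmax (y / x).
Proof.
have [->|y0] := eqVneq y 0; first by rewrite val_lt0 mul0r vmax0 => ->.
move=> x0; rewrite ltNge val_le_div //.
have := @val_le_div (y / x) 1.
by rewrite Defs.val1 mulf_neq0 ?invr_eq0 // invf_div mul1r /vmax ltNge => ->.
Qed.

Lemma vmaxE x : x != 0 -> vmax x = ~~ vring x^-1.
Proof.
move=> x0; have := @val_lt_div 1 x (oner_neq0 _); rewrite divr1 => <-.
by rewrite ltNge val_le_div // div1r.
Qed.

Lemma vringE x : x != 0 -> vring x = ~~ vmax x^-1.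
Proof. by move=> x0; rewrite vmaxE ?invr_eq0 // invrK negbK. Qed.

Lemma vmaxM x y : vmax x -> vring y -> vmax (x * y).
Proof.
have [->|x0] := eqVneq x 0; first by rewrite mul0r vmax0.
have [->|y0] := eqVneq y 0; first by rewrite mulr0 vmax0.
rewrite !vmaxE ?mulf_neq0 // => hx hy; apply: contra hx => h.
by rewrite -(mulfK y0 x) invfM invrK mulrC vringM // mulrC.
Qed.

Lemma vmax_sum (I : eqType) (r : seq I) (f : I -> L) :
  (forall i, i \in r -> vmax (f i)) -> vmax (\sum_(i <- r) f i).
Proof.
move=> h; rewrite big_seq; elim/big_ind: _ => //; [exact: vmax0|exact: vmaxD].
Qed.

Lemma vmaxX x n : (0 < n)%N -> vmax x -> vmax (x ^+ n).
Proof. by case: n => // n _ hx; rewrite exprS vmaxM // vringX // vmaxW. Qed.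

Lemma vringXE x n : (0 < n)%N -> vring (x ^+ n) = vring x.
Proof.
move=> n0; apply/idP/idP => [|/vringX//]; apply: contraLR => hx.
have x0 : x != 0 by apply: contraNneq hx => ->; apply: vring0.
by rewrite vringE ?expf_neq0 // negbK -exprVn vmaxX // vmaxE ?invr_eq0 // invrK.
Qed.

Lemma val_eq_div x y : x != 0 -> y != 0 ->
  (v x == v y) = vring (x / y) && vring (y / x).
Proof. by move=> x0 y0; rewrite eq_le !val_le_div // andbC. Qed.

Lemma valB x y : v (x - y) = v (y - x). Proof. by rewrite -opprB Defs.valN. Qed.

Lemma val_lt_sum x y : v x < v y -> v (x + y) = v x.
Proof.
move=> xy; apply: le_anti; apply/andP; split; last first.
  by apply: le_trans (Defs.valD v _ _); rewrite le_min lexx ltW.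
have := Defs.valD v (x + y) (- y); rewrite addrK Defs.valN ge_min => /orP[//|].
by rewrite leNgt xy.
Qed.

Lemma val_mulr_le x y z : v x <= v y -> v (x * z) <= v (y * z).
Proof.
have [->|z0] := eqVneq z 0; first by rewrite !mulr0.
have [->|x0] := eqVneq x 0.
  by rewrite leNgt val_lt0 negbK => /eqP ->.
by rewrite !val_le_div ?mulf_neq0 // -mulf_div divff // mulr1.
Qed.

Lemma vmax_unit x : vmax (x - 1) -> vring x && ~~ vmax x.
Proof.
move=> h; apply/andP; split; first by rewrite -(subrK 1 x) vringD ?vring1 // vmaxW.
by apply/negP => /vmaxB/(_ h); rewrite opprB addrC subrK vmax1.
Qed.

Lemma vmax_unitM x y : vmax (x - 1) -> vmax (y - 1) -> vmax (x * y - 1).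
Proof.
move=> hx hy; have -> : x * y - 1 = (x - 1) * y + (y - 1).
  by rewrite mulrBl mul1r addrA subrK.
by apply: vmaxD => //; apply: vmaxM => //; case/andP: (vmax_unit hy).
Qed.

Lemma vmax_unit_val x y : vmax (y / x - 1) -> v x = v y.
Proof.
move=> h; have /andP[h1 h2] := vmax_unit h.
have h0 : y / x != 0 by apply: contraNneq h2 => ->; apply: vmax0.
move: (h0); rewrite mulf_eq0 invr_eq0 negb_or => /andP[y0 x0].
by apply/eqP; rewrite val_eq_div // h1 andbT -invf_div vringE ?invr_eq0 // invrK.
Qed.

End Valuation.

Lemma valuation_equivP (L : fieldType) (G G' : oagType) (E : set L)
    (w : valuation L G') (v : valuation L G) : is_subfield E ->
  valuation_equiv E w v <-> forall x, E x -> vring w x = vring v x.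
Proof.
move=> sE; split=> [h x Ex|h x y Ex Ey].
  by have := h 1 x (subfield1 sE) Ex; rewrite !Defs.val1.
have [->|x0] := eqVneq x 0.
  by rewrite !leNgt !val_lt0.
by rewrite !val_le_div // h //; apply: subfield_div.
Qed.

Section Torsion.
Variables (F L : fieldType) (iota : {rmorphism F -> L}).
Variables (G : oagType) (v : valuation L G).

(* In a vanishing polynomial expression the minimal value is attained twice. *)
Lemma val_algebraic x : algebraicOver iota x -> x != 0 ->
  exists n (c : F), [/\ (0 < n)%N, c != 0 & v (x ^+ n) = v (iota c)].
Proof.
case=> p pN0 rp x0.
have sp : (0 < size p)%N by rewrite size_poly_gt0.
pose t (i : 'I_(size p)) := iota p`_i * x ^+ i.
(* The leading term is non-zero, which ensures that the minimum taken below is attained at a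
   non-zero term. *)
have lt_p : ((size p).-1 < size p)%N by rewrite prednK.
pose i0 : 'I_(size p) := Ordinal lt_p.
have t0 : t i0 != 0.
  by rewrite mulf_neq0 ?expf_neq0 // fmorph_eq0 -lead_coefE lead_coef_eq0.
case: (@Order.TotalTheory.arg_minP _ _ _ i0 xpredT (fun i => v (t i))) => // i _ mini.
have ti : t i != 0.
  by rewrite -(val_lt0 v); apply: le_lt_trans (mini i0 _) _; rewrite ?val_lt0.
have [j ji vij] : exists2 j, j != i & v (t j) = v (t i).
  apply: contrapT => noj.
  have st : \sum_(k < size p) t k = 0.
    rewrite -[RHS](rootP rp) (@horner_coef_wide _ (size p)) ?size_map_poly //.
    by apply: eq_bigr => k _; rewrite coef_map.
  move: st; rewrite (bigD1 i) //= => /eqP; rewrite addr_eq0 => /eqP e.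
  have : v (t i) < v (- \sum_(k < size p | k != i) t k).
    rewrite Defs.valN; elim/big_ind: _ => [|a b ha hb|k ki].
    - by rewrite val_lt0.
    - by apply: lt_le_trans (Defs.valD v _ _); rewrite lt_min ha hb.
    - rewrite lt_neqAle mini // andbT; apply/eqP => e'.
      by apply: noj; exists k.
  by rewrite -e ltxx.
have step (k l : 'I_(size p)) : (k < l)%N -> t k != 0 -> v (t k) = v (t l) ->
    exists n (c : F), [/\ (0 < n)%N, c != 0 & v (x ^+ n) = v (iota c)].
  move=> kl tk vkl.
  have tl : t l != 0 by rewrite -(val_lt0 v) -vkl val_lt0.
  have pk : p`_k != 0 by apply: contraNneq tk => h; rewrite /t h rmorph0 mul0r.
  have pl : p`_l != 0 by apply: contraNneq tl => h; rewrite /t h rmorph0 mul0r.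
  exists (l - k)%N, (p`_k / p`_l); rewrite subn_gt0 mulf_neq0 ?invr_eq0 //; split=> //.
  have xlk : x ^+ l = x ^+ k * x ^+ (l - k) by rewrite -exprD subnKC // ltnW.
  have ratio : t l / t k = x ^+ (l - k) / iota (p`_k / p`_l).
    rewrite /t xlk fmorph_div; field.
    by rewrite !fmorph_eq0 pk pl expf_neq0.
  have c0 : iota (p`_k / p`_l) != 0 by rewrite fmorph_eq0 mulf_neq0 ?invr_eq0.
  have xn : x ^+ (l - k) != 0 by rewrite expf_neq0.
  apply/eqP; move/eqP: vkl; rewrite !val_eq_div //.
  by rewrite -[t k / _]invf_div ratio invf_div andbC.
case: (ltngtP i j) => [ij|ij|/val_inj eij].
- exact: step ij ti (esym vij).
- by apply: (step _ _ ij _ vij); rewrite -(val_lt0 v) vij val_lt0.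
- by rewrite eij eqxx in ji.
Qed.

End Torsion.
(** * Extending homomorphisms of valued fields *)

(** [Zorn_bigcup] also demands the empty chain; replacing X by the union of A and X turns that case
    into the hypothesis on A. *)
Lemma Zorn_above (T : Type) (Q : set T -> Prop) (A : set T) : Q A ->
  (forall C : set (set T), C !=set0 -> C `<=` Q -> total_on C subset ->
    Q (\bigcup_(X in C) X)) ->
  exists M, [/\ A `<=` M, Q M & forall B, M `<=` B -> Q B -> B `<=` M].
Proof.
move=> QA Qcup; pose P X := Q (A `|` X).
have [|X [PX maxX]] := @Zorn_bigcup T P.
  move=> C CP totC; rewrite /P.
  have [->|/set0P[X0 CX0]] := eqVneq C set0; first by rewrite bigcup_set0 setU0.
  have -> : A `|` \bigcup_(X in C) X = \bigcup_(X in [set A `|` X | X in C]) X.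
    apply/seteqP; split=> [x [Ax|[X CX Xx]]|x [_ [X CX <-] [Ax|Xx]]].
    - by exists (A `|` X0); [exists X0|left].
    - by exists (A `|` X); [exists X|right].
    - by left.
    - by right; exists X.
  apply: Qcup => [|_ [X CX <-]|_ _ [X CX <-] [Y CY <-]].
  - by exists (A `|` X0), X0.
  - exact: CP.
  - by have [XY|YX] := totC _ _ CX CY; [left|right]; apply: setUS.
exists (A `|` X); split=> // B AXB QB x Bx; apply: contrapT => AXx.
apply: (maxX B); last by rewrite /P (setUidr _) // => y Ay; apply: AXB; left.
split; last by move=> BX; apply: AXx; right; apply: BX.
by move=> y Xy; apply: AXB; right.
Qed.

Lemma field_set_bigcup (R : comUnitRingType) (C : set (set R)) :
  C !=set0 -> (forall A, C A -> field_set A) -> total_on C subset ->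
  field_set (\bigcup_(A in C) A).
Proof.
move=> [A0 CA0] fC totC.
have two (x y : R) : (\bigcup_(A in C) A) x -> (\bigcup_(A in C) A) y ->
    exists A, [/\ C A, A x & A y].
  move=> [A CA Ax] [B CB By].
  by have [AB|BA] := totC _ _ CA CB; [exists B|exists A]; split=> //;
    [apply: AB|apply: BA].
split; last by move=> x [A CA Ax]; have [_ h] := fC _ CA; apply: h.
split; rewrite ?inE.
- by exists A0 => //; have [[h _ _] _] := fC _ CA0; have := h; rewrite inE.
- move=> x y; rewrite !inE => Ux /(two _ _ Ux)[A [CA Ax Ay]]; exists A => //.
  by have [[_ h _] _] := fC _ CA; have := h x y; rewrite !inE; apply.
- move=> x y; rewrite !inE => Ux /(two _ _ Ux)[A [CA Ax Ay]]; exists A => //.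
  by have [[_ _ h] _] := fC _ CA; have := h x y; rewrite !inE; apply.
Qed.

(** * Partial homomorphisms as fields of pairs *)

Section Graph.
Variables (L M : fieldType).
Implicit Types (A : set (L * M)).

(* A field inside L * M is the graph of a field hom from a subfield of L to M. *)
Lemma graph_field_set A :
  A 1 -> (forall u w, A u -> A w -> A (u - w)) ->
  (forall u w, A u -> A w -> A (u * w)) ->
  (forall u, A u -> u.1 = 0 -> u.2 = 0) ->
  (forall u, A u -> u.1 != 0 -> A (u.1^-1, u.2^-1) /\ u.2 != 0) ->
  field_set A.
Proof.
move=> A1 AB AM A0 AV.
have unit_ u : A u -> u != 0 -> u \is a GRing.unit.
  case: u => x y Au; have [/= x0|x0 _] := eqVneq x 0.
    by have /= y0 := A0 _ Au x0; rewrite x0 y0 eqxx.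
  have [_ /= y0] := AV _ Au x0.
  by rewrite unfold_in /= /pair_unitr /= !unitfE x0.
split=> //; split; rewrite ?inE // => u w; rewrite !inE => Au Aw.
  exact: AB.
have [->|w0] := eqVneq w 0.
  by rewrite invr0 -(subrr w) mulrBr; apply: AB; apply: AM.
have wu := unit_ _ Aw w0; apply: AM => //.
have w1 : w.1 != 0.
  by apply: contra_neq w0 => w1; have := A0 _ Aw w1; case: w w1 {Aw wu} => /= ? ? -> ->.
have [h w2] := AV _ Aw w1.
have -> // : w^-1 = (w.1^-1, w.2^-1).
apply: (mulIr wu); rewrite mulVr //.
by case: w w1 w2 {Aw wu h w0} => x y /= x0 y0; congr (_, _) => /=; rewrite mulVf.
Qed.

Variable A : set (L * M).
Hypothesis fA : field_set A.

Definition graph_dom (x : subfieldType fA) : L := (subfield_val x).1.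
Definition graph_cod (x : subfieldType fA) : M := (subfield_val x).2.

HB.instance Definition _ := GRing.RMorphism.copy graph_dom
  (fst \o subfield_val : {rmorphism subfieldType fA -> L}).
HB.instance Definition _ := GRing.RMorphism.copy graph_cod
  (snd \o subfield_val : {rmorphism subfieldType fA -> M}).

Lemma graph_mem (x : subfieldType fA) : A (graph_dom x, graph_cod x).
Proof.
have := mem_subfield_val x.
by rewrite /graph_dom /graph_cod; case: (subfield_val x).
Qed.

Lemma graph_memP u : A u ->
  exists x : subfieldType fA, graph_dom x = u.1 /\ graph_cod x = u.2.
Proof.
move=> Au; have : range (subfield_val : subfieldType fA -> L * M) u.
  by rewrite range_subfield_val.
by case=> x _ <-; exists x; rewrite /graph_dom /graph_cod.
Qed.

Lemma graph_fun u w : A u -> A w -> u.1 = w.1 -> u.2 = w.2.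
Proof.
move=> /graph_memP[x [<- <-]] /graph_memP[y [<- <-]].
by move=> /fmorph_inj ->.
Qed.

End Graph.

Section GraphAdjoin.
Variables (F L M : fieldType) (i : {rmorphism F -> L}) (j : {rmorphism F -> M}).
Variables (a : L) (p : {poly F}) (b : M).

(** The graph of the hom F(a) -> M over F sending [a] to [b]. That it is single-valued is
    [minpoly_root_transfer]. *)
Definition adjoin_graph : set (L * M) :=
  [set ((map_poly i q).[a], (map_poly j q).[b]) | q in [set: {poly F}]].

Hypotheses (pmin : is_minpoly i a p) (rb : root (map_poly j p) b).

Lemma adjoin_graph_field_set : field_set adjoin_graph.
Proof.
apply: graph_field_set.
- by exists 1 => //; rewrite !rmorph1 !hornerC.
- by move=> _ _ [q _ <-] [r _ <-]; exists (q - r) => //; rewrite !rmorphB !hornerE.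
- by move=> _ _ [q _ <-] [r _ <-]; exists (q * r) => //; rewrite !rmorphM !hornerM.
- move=> _ [q _ <-] /= /rootP; rewrite -(minpoly_root_transfer pmin _ rb).
  by move/rootP.
- move=> _ [q _ <-] /= q0.
  have rq : ~~ root (map_poly i q) a by [].
  have rq' : ~~ root (map_poly j q) b by rewrite (minpoly_root_transfer pmin _ rb).
  split=> //; have [u eu] := horner_inv pmin rq; exists u => //; rewrite eu; congr (_, _).
  have : root (map_poly j (u * q - 1)) b.
    rewrite (minpoly_root_transfer pmin _ rb) /root rmorphB rmorphM rmorph1 !hornerE.
    by rewrite eu mulVf ?subrr.
  rewrite rmorphB rmorphM rmorph1 /root !hornerE subr_eq0 => /eqP uq.
  by apply: (mulIf rq'); rewrite mulVf.
Qed.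

Lemma adjoin_graph_sub c : adjoin_graph (i c, j c).
Proof. by exists c%:P => //; rewrite !map_polyC !hornerC. Qed.

Lemma adjoin_graph_mem : adjoin_graph (a, b).
Proof. by exists 'X => //; rewrite !map_polyX !hornerX. Qed.

End GraphAdjoin.
(** Lets the graph of a partial hom act as a new base field: its two projections are homs to L and
    M, through which [i] and [j] both factor. *)
Lemma graph_lift (F L M : fieldType) (i : {rmorphism F -> L})
    (j : {rmorphism F -> M}) (A : set (L * M)) (fA : field_set A) (q : {poly F}) :
  (forall c, A (i c, j c)) ->
  exists r : {poly subfieldType fA},
    map_poly (@graph_dom _ _ _ fA) r = map_poly i q /\
    map_poly (@graph_cod _ _ _ fA) r = map_poly j q.
Proof.
move=> Aij; have /choice[e he] : forall c, exists x : subfieldType fA,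
    graph_dom x = i c /\ graph_cod x = j c by move=> c; exact: (graph_memP fA (Aij c)).
exists (\poly_(k < size q) e q`_k); split; apply/polyP => k;
  rewrite !coef_map coef_poly; have [h1 h2] := he q`_k.
  by case: ltnP => // /(nth_default 0) ->; exact: etrans (rmorph0 _) (esym (rmorph0 _)).
by case: ltnP => // /(nth_default 0) ->; exact: etrans (rmorph0 _) (esym (rmorph0 _)).
Qed.

Lemma closed_root (M : closedFieldType) (q : {poly M}) :
  (1 < size q)%N -> exists b, root q b.
Proof. by move=> sq; apply/closed_rootP; rewrite gtn_eqF. Qed.

Section Conjugates.
Variables (F L : fieldType) (M : closedFieldType).
Variables (i : {rmorphism F -> L}) (j : {rmorphism F -> M}).
Variables (a : L) (p : {poly F}).
Hypothesis pmin : is_minpoly i a p.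

(** The hom F(u(a)) -> M sending u(a) to [c] extends to [a]: take the minimal polynomial of [a] over
    its graph and any root [b] of the image in M. *)
Lemma root_minpoly_horner (u m : {poly F}) (c : M) :
  is_minpoly i (map_poly i u).[a] m -> root (map_poly j m) c ->
  exists2 b, root (map_poly j p) b & (map_poly j u).[b] = c.
Proof.
move=> mmin rc; pose y := (map_poly i u).[a].
have fN := adjoin_graph_field_set mmin rc.
have Nij := adjoin_graph_sub i j y c.
have [p1 [p1i p1j]] := graph_lift fN p Nij.
have [u1 [u1i u1j]] := graph_lift fN u Nij.
have [y1 [y1i y1j]] := graph_memP fN (adjoin_graph_mem i j y c).
have ra : root (map_poly (@graph_dom _ _ _ fN) p1) a by rewrite p1i; case: pmin.
have p1N0 : p1 != 0.
  by rewrite -(map_poly_eq0 (@graph_dom _ _ _ fN)) p1i map_poly_eq0 (minpoly_neq0 pmin).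
have [r rmin] : exists r, is_minpoly (@graph_dom _ _ _ fN) a r.
  by apply: exists_minpoly; exists p1.
have [b rb] : exists b, root (map_poly (@graph_cod _ _ _ fN) r) b.
  by apply: closed_root; rewrite size_map_poly (minpoly_size_gt1 rmin).
exists b; first by rewrite -p1j (minpoly_root_transfer rmin _ rb).
have : root (map_poly (@graph_cod _ _ _ fN) (u1 - y1%:P)) b.
  rewrite (minpoly_root_transfer rmin _ rb) rmorphB /= map_polyC u1i /=.
  by rewrite /root !hornerE y1i subrr.
rewrite rmorphB /= map_polyC u1j /=.
by rewrite /root !hornerE y1j subr_eq0 => /eqP.
Qed.

End Conjugates.

Section CoefProd.
Variables (L : fieldType) (G : oagType) (v : valuation L G).

Lemma vmax_coef_prod_XsubC (s : seq L) k :
  (forall c, c \in s -> vmax v c) -> (k < size s)%N ->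
  vmax v (\prod_(c <- s) ('X - c%:P))`_k.
Proof.
elim: s k => // c s IH k hs ks; rewrite big_cons mulrBl coefB coefXM coefCM.
have hP l : vring v (\prod_(c <- s) ('X - c%:P))`_l.
  have [ls|] := ltnP l (size s).
    by apply/vmaxW/IH => // d ds; apply: hs; rewrite inE ds orbT.
  rewrite leq_eqVlt => /orP[/eqP <-|sl]; last first.
    by rewrite nth_default ?vring0 // size_prod_XsubC.
  have : lead_coef (\prod_(c <- s) ('X - c%:P)) = 1.
    by apply/eqP; rewrite -monicE monic_prod_XsubC.
  by rewrite lead_coefE size_prod_XsubC => ->; apply: vring1.
apply: vmaxB; last by rewrite vmaxM ?hs ?mem_head.
case: k ks => [|k] ks; first exact: vmax0.
by apply: IH => // d ds; apply: hs; rewrite inE ds orbT.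
Qed.

(* At most one exponent is bad for each index [b]: two of them would make [g b],
   and hence [f b], a unit. *)
Lemma avoid_exponents (T : eqType) (s : seq T) (f g : T -> L) N :
  (forall b, b \in s -> ~~ vring v (f b)) ->
  exists2 t, (N < t)%N & forall b, b \in s -> v (f b) != v (g b ^+ t).
Proof.
elim: s N => [|b s IH] N hs; first by exists N.+1.
have hb : ~~ vring v (f b) by apply: hs; rewrite mem_head.
have fb0 : f b != 0 by apply: contraNneq hb => ->; apply: vring0.
have hs' : forall b, b \in s -> ~~ vring v (f b).
  by move=> c cs; apply: hs; rewrite inE cs orbT.
have [[t0 t0N vt0]|noN] := pselect (exists2 t, (N < t)%N & v (f b) = v (g b ^+ t)).
  (* Past its bad exponent t0 the index [b] has no other one, so an exponent for the tail is sought
     beyond t0; this is why the bound N is carried along. *)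
  have [t tt0 ht] := IH t0 hs'; exists t; first exact: ltn_trans tt0.
  move=> c; rewrite inE => /orP[/eqP ->|/ht //]; apply/eqP => vt.
  have gt0 : g b != 0.
    apply: contra_eq_neq vt0 => ->; rewrite expr0n gtn_eqF ?(leq_ltn_trans _ t0N) //.
    by apply/negP => /eqP e; have := val_lt0 v (f b); rewrite e ltxx fb0.
  have gtt0 : vring v (g b ^+ (t - t0)) && vring v ((g b ^+ (t - t0))^-1).
    have /eqP : v (g b ^+ t0) = v (g b ^+ t) by rewrite -vt0.
    have -> : g b ^+ t = g b ^+ t0 * g b ^+ (t - t0) by rewrite -exprD subnKC // ltnW.
    rewrite val_eq_div ?mulf_neq0 ?expf_neq0 // invfM mulrA.
    by rewrite divff ?expf_neq0 // mul1r mulrAC divff ?expf_neq0 // mul1r andbC.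
  have gu : vring v (g b) by case/andP: gtt0 => h _; rewrite vringXE ?subn_gt0 in h.
  by case/negP: hb; rewrite /vring vt0; apply: vringX.
have [t tN ht] := IH N hs'; exists t => // c; rewrite inE => /orP[/eqP ->|/ht //].
by apply/eqP => vt; apply: noN; exists t.
Qed.

End CoefProd.
Section Extension.
Variables (F L : fieldType) (M : closedFieldType).
Variables (i : {rmorphism F -> L}) (j : {rmorphism F -> M}).
Variables (G G' : oagType) (w : valuation L G') (v : valuation M G).
Hypothesis ij_ring : forall c, vring w (i c) -> vring v (j c).

Lemma vmax_transfer c : vmax v (j c) -> vmax w (i c).
Proof.
have [->|c0] := eqVneq c 0; first by rewrite !rmorph0 !vmax0.
rewrite !vmaxE ?fmorph_eq0 //; apply: contra.
by rewrite -!fmorphV; apply: ij_ring.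
Qed.

Variables (a : L) (p : {poly F}).
Hypothesis pmin : is_minpoly i a p.

(* If every conjugate [b] failed, some [y] in F(a) would be integral for [w]
   while all its conjugates have a pole; then [y^-1] is a root of a monic
   polynomial whose lower coefficients lie in the maximal ideal. *)
Lemma extension_step : exists2 b, root (map_poly j p) b &
  forall q, vring w (map_poly i q).[a] -> vring v (map_poly j q).[b].
Proof.
have [_ rp _] := pmin.
have [rs rsE] := closed_field_poly_normal (map_poly j p).
have pj0 : map_poly j p != 0 by rewrite map_poly_eq0 (minpoly_neq0 pmin).
have rsP b : (b \in rs) = root (map_poly j p) b.
  by rewrite rsE rootZ ?lead_coef_eq0 // root_prod_XsubC.
apply: contrapT => noext.
have bad b : b \in rs -> exists2 q, vring w (map_poly i q).[a] &
    ~~ vring v (map_poly j q).[b].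
  rewrite rsP => rb; apply: contrapT => nob; apply: noext; exists b => // q hq.
  by apply: contrapT => /negP hq'; apply: nob; exists q.
have [q qw qv] : exists2 q, vring w (map_poly i q).[a] &
    forall b, b \in rs -> ~~ vring v (map_poly j q).[b].
  elim: rs {rsE rsP} bad => [|b s IH] bad.
    by exists 0; rewrite // rmorph0 horner0 vring0.
  have [|q qw qv] := IH; first by move=> c cs; apply: bad; rewrite inE cs orbT.
  have [qb|qb] := boolP (vring v (map_poly j q).[b]); last first.
    by exists q => // c; rewrite inE => /orP[/eqP ->|/qv].
  have [r rw rb] := bad b (mem_head _ _).
  have [t t0 ht] := avoid_exponents (fun c => (map_poly j r).[c]) 0 qv.
  (* At [b] only the second summand has a pole. At the earlier conjugates q has a pole, and t was
     chosen so that the summands have different values and cannot cancel. *)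
  exists (q + r ^+ t).
    by rewrite rmorphD rmorphXn /= hornerD horner_exp vringD // vringX.
  move=> c; rewrite rmorphD rmorphXn /= hornerD horner_exp inE => /orP[/eqP ->|cs].
    apply/negP => /vringB/(_ qb); rewrite addrAC subrr add0r vringXE //.
    exact/negP.
  have := ht c cs; have := qv c cs; rewrite /vring -!ltNge => qc.
  rewrite neq_lt => /orP[lt1|lt1]; first by rewrite val_lt_sum.
  by rewrite addrC val_lt_sum // (lt_trans lt1).
have [b0 b0rs] : exists b, b \in rs.
  have [|b rb] := @closed_root _ (map_poly j p); last by exists b; rewrite rsP.
  by rewrite size_map_poly (minpoly_size_gt1 pmin).
have qa0 : ~~ root (map_poly i q) a.
  apply/negP; rewrite -(@minpoly_root_transfer _ _ _ _ _ pmin _ j b0) -?rsP //.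
  by move=> /rootP h; have := qv _ b0rs; rewrite h vring0.
have [u uE] := horner_inv pmin qa0.
have uqj b : b \in rs -> vmax v (map_poly j u).[b].
  move=> brs; have qb := qv b brs.
  have : root (map_poly j (u * q - 1)) b.
    rewrite (minpoly_root_transfer pmin) -?rsP //.
    by rewrite /root rmorphB rmorphM rmorph1 !hornerE uE mulVf ?subrr.
  rewrite rmorphB rmorphM rmorph1 /root !hornerE subr_eq0 => /eqP uq.
  have qb0 : (map_poly j q).[b] != 0 by apply: contraNneq qb => ->; apply: vring0.
  have -> : (map_poly j u).[b] = (map_poly j q).[b]^-1.
    by apply: (mulIf qb0); rewrite uq mulVf.
  by rewrite vmaxE ?invr_eq0 // invrK.
set y := (map_poly i q).[a] in qw uE.
have y0 : y != 0 := qa0.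
have [m mmin] : exists m, is_minpoly i (map_poly i u).[a] m.
  apply: exists_minpoly; apply/integral_algebraic/integral_horner.
    by move=> c /(nthP 0)[k _ <-]; rewrite coef_map; apply: integral_id.
  by apply/integral_algebraic; exists p; rewrite ?(minpoly_neq0 pmin).
have [mm rm _] := mmin; have sm := minpoly_size_gt1 mmin.
have [cs csE] := closed_field_poly_normal (map_poly j m).
have lm : lead_coef (map_poly j m) = 1 by apply/monicP; rewrite map_monic.
rewrite lm scale1r in csE.
have csv c : c \in cs -> vmax v c.
  rewrite -root_prod_XsubC -csE => /(root_minpoly_horner pmin mmin)[b rb <-].
  by apply: uqj; rewrite rsP.
have mk k : (k < (size m).-1)%N -> vmax w (i m`_k).
  move=> km; apply: vmax_transfer; rewrite -coef_map csE vmax_coef_prod_XsubC //.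
  have := size_map_poly j m; rewrite csE size_prod_XsubC => e.
  by rewrite -e in km.
have : vmax w 1; last by rewrite vmax1.
have smE : size m = (size m).-1.+1 by rewrite prednK // ltnW.
move: rm; rewrite uE /root horner_coef size_map_poly smE big_ord_recr /=.
have -> : (map_poly i m)`_(size m).-1 = 1.
  rewrite -(size_map_poly i m) -lead_coefE.
  by apply/monicP; rewrite map_monic.
rewrite mul1r addrC addr_eq0 => /eqP ey.
(* The relation m(y^-1) = 0 multiplied by the power of y that clears denominators: each remaining
   term has a coefficient in the maximal ideal and an integral power of y. *)
have -> : 1 = - \sum_(k < (size m).-1) i m`_k * y ^+ ((size m).-1 - k).
  rewrite -[LHS](@mulfV _ (y ^+ (size m).-1)) ?expf_neq0 // -exprVn ey mulrN mulr_sumr.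
  congr (- _); apply: eq_bigr => k _; rewrite coef_map mulrCA; congr (_ * _).
  have {1}-> : (size m).-1 = ((size m).-1 - k + k)%N by rewrite subnK // ltnW.
  by rewrite exprD -mulrA -exprMn mulfV // expr1n mulr1.
rewrite vmaxN; apply: vmax_sum => k _.
by apply: vmaxM; [apply: mk|apply: vringX].
Qed.

End Extension.
Lemma rmorphism_of_fun (R S : nzRingType) (f : R -> S) :
  {morph f : x y / x - y} -> {morph f : x y / x * y} -> f 1 = 1 ->
  exists s : {rmorphism R -> S}, forall x, s x = f x.
Proof.
move=> fB fM f1.
pose zf := GRing.isZmodMorphism.Build R S f fB.
pose mf := GRing.isMonoidMorphism.Build R S f (conj f1 fM).
pose s := HB.pack_for {rmorphism R -> S} f zf mf.
by exists s.
Qed.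

Section GraphExtension.
Variables (L : fieldType) (M : closedFieldType) (G G' : oagType).
Variables (w : valuation L G') (v : valuation M G).
Variables (A : set (L * M)) (fA : field_set A).
Hypothesis algA : forall x, algebraicOver (@graph_dom _ _ _ fA) x.

(** A maximal field of pairs that keeps integrality is total: for any [a], [extension_step] over
    that field provides a [b] such that adjoining (a, b) keeps the property, so maximality already
    contains the pair. *)
Lemma graph_extension : (forall u, A u -> vring w u.1 -> vring v u.2) ->
  exists s : {rmorphism L -> M}, (forall u, A u -> s u.1 = u.2) /\
    forall x, vring w x -> vring v (s x).
Proof.
move=> Aring.
pose Q (X : set (L * M)) :=
  field_set X /\ forall u, X u -> vring w u.1 -> vring v u.2.
have [||X [AX [fX Xring] maxX]] := @Zorn_above _ Q A; first by [].
  move=> C C0 CQ totC; split; first by apply: field_set_bigcup => // X /CQ[].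
  by move=> u [X /CQ[_ h] Xu]; apply: h.
have Xtot a : exists b, X (a, b).
  have [q qN0 rq] := algA a.
  have [r [ri _]] := graph_lift (i := @graph_dom _ _ _ fA) (j := @graph_cod _ _ _ fA)
    fX q (fun c => AX _ (graph_mem c)).
  have [p pmin] : exists p, is_minpoly (@graph_dom _ _ _ fX) a p.
    apply: exists_minpoly; exists r; last by rewrite ri.
    by rewrite -(map_poly_eq0 (@graph_dom _ _ _ fX)) ri map_poly_eq0.
  have [|b rb hb] := @extension_step _ _ _ (@graph_dom _ _ _ fX) (@graph_cod _ _ _ fX)
    _ _ w v _ _ _ pmin.
    by move=> c; apply: (Xring _ (graph_mem c)).
  exists b; apply: maxX (adjoin_graph_mem _ _ _ _).
    move=> u /(graph_memP fX)[c [cd cc]].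
    have -> : u = (graph_dom c, graph_cod c) by rewrite cd cc -surjective_pairing.
    exact: (adjoin_graph_sub (@graph_dom _ _ _ fX) (@graph_cod _ _ _ fX)).
  split; first exact: (adjoin_graph_field_set pmin rb).
  by move=> _ [q' _ <-] /=; apply: hb.
have /choice[f Xf] := Xtot.
have [[X1 XB Xdiv] _] := fX.
have fE u : X u -> f u.1 = u.2 by move=> Xu; apply: (graph_fun fX (Xf u.1) Xu).
have XM u t : X u -> X t -> X (u * t).
  move=> /(graph_memP fX)[x [xd xc]] /(graph_memP fX)[y [yd yc]].
  have := graph_mem (x * y).
  case: u t xd xc yd yc => u1 u2 [t1 t2] /= xd xc yd yc.
  by rewrite !rmorphM /= xd xc yd yc.
have f_sub : {morph f : x y / x - y}.
  move=> x y; have := XB (x, f x) (y, f y); rewrite !inE => /(_ (Xf x) (Xf y)).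
  exact: fE.
have f_mul : {morph f : x y / x * y}.
  by move=> x y; apply: (fE (x * y, f x * f y)); apply: (XM _ _ (Xf x) (Xf y)).
have f_one : f 1 = 1 by have := X1; rewrite inE => /fE.
have [s sE] := rmorphism_of_fun f_sub f_mul f_one.
exists s; split=> [u Au|x]; first by rewrite sE; apply: fE; apply: AX.
by rewrite sE; apply: (Xring _ (Xf x)).
Qed.

(** For the converse implication, some power of x has the value of an element c of the domain of A.
    If x is not integral, neither is c; but integrality of s x would make s c integral, and on A the
    two rings agree. *)
Lemma graph_extension_equiv : (forall u, A u -> vring w u.1 = vring v u.2) ->
  exists s : {rmorphism L -> M}, (forall u, A u -> s u.1 = u.2) /\
    forall x, vring v (s x) = vring w x.
Proof.
move=> Aring; have [u Au|s [sA sring]] := graph_extension; first by rewrite Aring.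
exists s; split=> // x; apply/idP/idP; last exact: sring.
apply: contraLR => hx; have x0 : x != 0 by apply: contraNneq hx => ->; apply: vring0.
have [n [c [n0 c0 e]]] := val_algebraic w (algA x) x0.
have /eqP := e; rewrite val_eq_div ?expf_neq0 ?fmorph_eq0 // => /andP[_].
move=> /sring cx.
have : ~~ vring w (graph_dom c) by rewrite /vring -e -/(vring w _) vringXE.
have /= sc := sA _ (graph_mem c); have /= -> := Aring _ (graph_mem c).
rewrite -sc; apply: contra => sx.
have -> : s (graph_dom c) = s (graph_dom c / x ^+ n) * s x ^+ n.
  by rewrite -rmorphXn -rmorphM divfK // expf_neq0.
by rewrite vringM // vringX.
Qed.

End GraphExtension.
Section HomExtension.
Variables (F L : fieldType) (M : closedFieldType).
Variables (i : {rmorphism F -> L}) (j : {rmorphism F -> M}).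
Hypothesis algi : forall x, algebraicOver i x.
Variables (G G' : oagType) (w : valuation L G') (v : valuation M G).

Lemma hom_extension_adjoin (a : L) (p : {poly F}) (b : M) :
  is_minpoly i a p -> root (map_poly j p) b ->
  (forall q, vring w (map_poly i q).[a] = vring v (map_poly j q).[b]) ->
  exists s : {rmorphism L -> M}, [/\ forall c, s (i c) = j c, s a = b
    & forall x, vring v (s x) = vring w x].
Proof.
move=> pmin rb ring_q; have fN := adjoin_graph_field_set pmin rb.
have Nij := adjoin_graph_sub i j a b.
have algN x : algebraicOver (@graph_dom _ _ _ fN) x.
  have [q qN0 rq] := algi x; have [r [ri _]] := graph_lift fN q Nij.
  exists r; last by rewrite ri.
  by rewrite -(map_poly_eq0 (@graph_dom _ _ _ fN)) ri map_poly_eq0.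
have [|s [sN sv]] := @graph_extension_equiv _ _ _ _ w v _ fN algN.
  by move=> _ [q _ <-] /=.
exists s; split=> // [c|]; first exact: (sN _ (Nij c)).
exact: (sN _ (adjoin_graph_mem i j a b)).
Qed.

Lemma hom_extension : (forall c, vring w (i c) = vring v (j c)) ->
  exists s : {rmorphism L -> M}, (forall c, s (i c) = j c)
    /\ forall x, vring v (s x) = vring w x.
Proof.
move=> ring_ij.
(* Extending from F itself is the case of adjoining 0. *)
have Xmin : is_minpoly i 0 'X.
  split; [exact: monicX|by rewrite map_polyX rootX|].
  move=> q qN0 rq; rewrite size_polyX ltnNge; apply/negP => /size1_polyC qC.
  case/eqP: qN0; move: rq; rewrite qC map_polyC rootC (fmorph_eq0 i) => /eqP h.
  by rewrite h.
have [||s [si _ sv]] := @hom_extension_adjoin 0 'X 0 Xmin; last (by exists s; split).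
  by rewrite map_polyX rootX.
by move=> q; rewrite !horner_coef0 !coef_map; apply: ring_ij.
Qed.

End HomExtension.

Section TrivialValuation.
Variables (L : fieldType) (G : oagType).

(* Homs preserve trivial valuations, so extension theorems for valued fields
   specialize to plain fields. *)
Definition trivial_val (x : L) : with_oo G := if x == 0 then None else Some 0.

Fact trivial_valP : valuation_on setT trivial_val.
Proof.
rewrite /trivial_val; split=> [x _|x y _ _|x y _ _].
- by split=> [|->]; [case: eqP|rewrite eqxx].
- by rewrite mulf_eq0; case: eqP => //=; case: eqP => //= _ _; rewrite addr0.
- case: (eqVneq (x + y) 0) => [_|xy]; first exact: val_le_None.
  rewrite ge_min; case: eqP => [x0|_]; last by rewrite lexx.
  by case: eqP => [y0|_]; [rewrite x0 y0 addr0 eqxx in xy|rewrite lexx orbT].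
Qed.

Definition trivial_valuation := Valuation trivial_valP.

Lemma vring_trivial x : vring trivial_valuation x.
Proof. by rewrite /vring /= /trivial_val; case: eqP => // _; apply: lexx. Qed.

End TrivialValuation.

Fact hom_valuationP (L M : fieldType) (G : oagType) (v : valuation M G)
  (s : {rmorphism L -> M}) : valuation_on setT (v \o s).
Proof.
split=> [x _|x y _ _|x y _ _] /=.
- by split=> [/val_None/eqP|->]; [rewrite fmorph_eq0 => /eqP|rewrite rmorph0 val0].
- by rewrite rmorphM Defs.valM.
- by rewrite rmorphD Defs.valD.
Qed.

Definition hom_valuation (L M : fieldType) (G : oagType) (v : valuation M G)
  (s : {rmorphism L -> M}) := Valuation (hom_valuationP v s).

(** * Decomposition group and henselization *)

Section Decomposition.
Variables (K : fieldType) (L : closedFieldType) (iota : {rmorphism K -> L}).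
Hypothesis algK : forall x, algebraicOver iota x.
Variables (G : oagType) (v : valuation L G).

(* The monoid of K-endomorphisms of L preserving [v]: as L is algebraic over K,
   it is the decomposition group. *)
Definition decomposition (s : {rmorphism L -> L}) : Prop :=
  (forall c, s (iota c) = iota c) /\ forall x, vring v (s x) = vring v x.

(** It contains every element purely inseparable over K, so it can be strictly larger than the
    henselization. *)
Definition decomposition_field : set L :=
  [set x | forall s, decomposition s -> s x = x].

Lemma decomposition_comp s t : decomposition s -> decomposition t ->
  decomposition (s \o t).
Proof.
by move=> [sK sv] [tK tv]; split=> [c|x] /=; rewrite ?tK ?sK // sv tv.
Qed.

(** Preserving the valuation ring is enough: a power of x has the value of some element of K, which
    s fixes, so that power keeps its value, and the order on G allows taking the root. *)
Lemma decomposition_val s x : decomposition s -> v (s x) = v x.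
Proof.
move=> [sK sv]; have [->|x0] := eqVneq x 0; first by rewrite rmorph0.
have [n [c [n0 c0 e]]] := val_algebraic v (algK x) x0.
have sx0 : s x != 0 by rewrite fmorph_eq0.
have ic0 : iota c != 0 by rewrite fmorph_eq0.
have e' : v (s x ^+ n) = v (x ^+ n).
  rewrite e; apply/eqP; move/eqP: e; rewrite !val_eq_div ?expf_neq0 //.
  by rewrite -(sv (_ / _)) -(sv (iota c / _)) !fmorph_div !rmorphXn /= !sK.
move/eqP: e'; rewrite !val_eq_div ?expf_neq0 // -!expr_div_n !vringXE //.
by move=> h; apply/eqP; rewrite val_eq_div.
Qed.

Lemma decomposition_field_subfield : is_subfield decomposition_field.
Proof.
split; rewrite ?inE.
- by move=> s _; apply: rmorph1.
- by move=> x y; rewrite !inE => hx hy s Ds; rewrite rmorphB hx ?hy.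
- by move=> x y; rewrite !inE => hx hy s Ds; rewrite fmorph_div hx ?hy.
Qed.

Lemma sub_decomposition_field : range iota `<=` decomposition_field.
Proof. by move=> _ [c _ <-] s [sK _]. Qed.

Lemma algebraic_over_subfield (E : set L) (fE : field_set E) x :
  range iota `<=` E ->
  algebraicOver (subfield_val : {rmorphism subfieldType fE -> L}) x.
Proof.
move=> KE; have [q qN0 rq] := algK x.
have [r rE] : exists r, map_poly (@subfield_val _ _ fE) r = map_poly iota q.
  apply: (poly_lift (iota := @subfield_val _ _ fE)) => k.
  by rewrite range_subfield_val coef_map; apply: KE; exists q`_k.
exists r; last by rewrite rE.
by rewrite -(map_poly_eq0 (@subfield_val _ _ fE)) rE map_poly_eq0.
Qed.

Lemma exists_conj_hom (F : fieldType) (i : {rmorphism F -> L}) a p b :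
  (forall x, algebraicOver i x) -> is_minpoly i a p -> root (map_poly i p) b ->
  exists s : {rmorphism L -> L}, (forall c, s (i c) = i c) /\ s a = b.
Proof.
move=> algi pmin rb.
have [|s [si sa _]] := @hom_extension_adjoin _ _ _ _ _ algi _ _
  (trivial_valuation L G) (trivial_valuation L G) _ _ _ pmin rb; last by exists s.
by move=> q; rewrite !vring_trivial.
Qed.

(** Conjugates over E are linked by some endomorphism s over E. Then v composed with s is another
    extension of the valuation of E, hence equivalent to v, so s lies in the decomposition group. *)
Lemma henselian_conj (E : set L) (fE : field_set E) a p b :
  range iota `<=` E -> henselian v E ->
  is_minpoly (@subfield_val _ _ fE) a p ->
  root (map_poly (@subfield_val _ _ fE) p) b ->
  exists2 s, decomposition s & s a = b.
Proof.
move=> KE [sE hE] pmin rb.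
have [s [sfix sa]] := exists_conj_hom
  (fun x => algebraic_over_subfield fE x KE) pmin rb.
have sE' x : E x -> s x = x.
  move=> Ex; have [y _ <-] : range (@subfield_val _ _ fE) x by rewrite range_subfield_val.
  exact: sfix.
exists s => //; split=> [c|x]; first by apply/sE'/KE; exists c.
have sT : is_subfield [set: L] by split; rewrite ?inE // => *; rewrite inE.
have := hE G (v \o s) (hom_valuationP v s).
move=> /(_ _)/(valuation_equivP (hom_valuation v s) v sT)/(_ x I); apply.
by move=> y z Ey Ez /=; rewrite !sE'.
Qed.

(** The orbit of z is finite, being contained in the roots of a polynomial over K, and the group
    permutes it. So the monic polynomial with the orbit as simple roots has coefficients in the
    decomposition field, and p divides it. *)
Lemma decomposition_orbit (fD : field_set decomposition_field) z p b :
  is_minpoly (@subfield_val _ _ fD) z p ->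
  root (map_poly (@subfield_val _ _ fD) p) b ->
  exists2 s, decomposition s & s z = b.
Proof.
move=> pmin rb; have [q qN0 rq] := algK z.
have [rs rsE] := closed_field_poly_normal (map_poly iota q).
have rsP c : (c \in rs) = root (map_poly iota q) c.
  by rewrite rsE rootZ ?lead_coef_eq0 ?map_poly_eq0 // root_prod_XsubC.
pose orb := undup [seq c <- rs | `[< exists2 s, decomposition s & s z = c >]].
have orbP c : c \in orb <-> exists2 s, decomposition s & s z = c.
  rewrite mem_undup mem_filter; split=> [/andP[/asboolP]//|[s Ds sz]].
  apply/andP; split; first by apply/asboolP; exists s.
  have [sK _] := Ds; rewrite rsP -sz.
  have -> : map_poly iota q = map_poly s (map_poly iota q).
    by rewrite -map_poly_comp; apply: eq_map_poly => k /=; rewrite sK.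
  by rewrite fmorph_root.
pose r := \prod_(c <- orb) ('X - c%:P).
have rfix k : decomposition_field r`_k.
  move=> s Ds; rewrite -coef_map /r map_prod_XsubC.
  have <- : \prod_(c <- map s orb) ('X - c%:P) = \prod_(c <- orb) ('X - (s c)%:P).
    by rewrite big_map.
  apply: (congr1 (fun t : {poly L} => t`_k)); apply: perm_big; have us : uniq (map s orb).
    by rewrite map_inj_uniq ?undup_uniq //; apply: fmorph_inj.
  apply: uniq_perm => //; first exact: undup_uniq.
  have [||_ e] := @uniq_min_size _ (map s orb) orb us; last exact: e.
    move=> _ /mapP[c /orbP[t Dt tz] ->]; apply/orbP.
    by exists (s \o t); [apply: decomposition_comp|rewrite /= tz].
  by rewrite size_map.
have [r0 r0E] : exists r0, map_poly (@subfield_val _ _ fD) r0 = r.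
  by apply: (poly_lift (iota := @subfield_val _ _ fD)) => k; rewrite range_subfield_val.
apply/orbP; rewrite -root_prod_XsubC -/r -r0E (minpoly_root_transfer pmin _ rb) r0E.
rewrite root_prod_XsubC; apply/orbP; exists idfun => //; split=> //.
Qed.

(* An extension [w] of the valuation from E is carried to [v] by a hom fixing
   the decomposition field; on each single element this hom agrees with some
   element of the decomposition group, so [w] and [v] are equivalent. *)
Lemma henselian_radical (E : set L) : is_subfield E ->
  (forall x, decomposition_field x -> exists2 n, (0 < n)%N & E (x ^+ n)) ->
  henselian v E.
Proof.
move=> sE rad; split=> // G' w wval.
have sT : is_subfield [set: L] by split; rewrite ?inE // => *; rewrite inE.
move/(valuation_equivP (Valuation wval) v sE) => wv.
apply/(valuation_equivP (Valuation wval) v sT) => z _.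
have fD := subfield_field_set decomposition_field_subfield.
have algD x := algebraic_over_subfield fD x sub_decomposition_field.
have [|s [sD sv]] := hom_extension (j := @subfield_val _ _ fD) algD
  (w := Valuation wval) (v := v).
  (* A power of c lies in E, where w and v agree, and c is integral as soon as that power is. *)
  move=> c; have [] := rad _ (mem_subfield_val c).
  by move=> n n0 /wv; rewrite !vringXE.
have [p pmin] := exists_minpoly (algD z).
have [|t Dt tz] := @decomposition_orbit fD z p (s z) pmin.
  have -> : map_poly (@subfield_val _ _ fD) p =
      map_poly s (map_poly (@subfield_val _ _ fD) p).
    by rewrite -map_poly_comp; apply: eq_map_poly => k /=; rewrite sD.
  by rewrite fmorph_root; case: pmin.
by rewrite -sv -tz; case: Dt => _ ->.
Qed.

End Decomposition.

(** * Separability and radical elements *)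

Section Separable.
Variable L : fieldType.
Implicit Types (E : set L) (x y a b : L).

(** Asking for a simple root of any polynomial over E, rather than of the minimal one, makes passage
    to a larger field immediate. *)
Definition separable_over E x : Prop :=
  exists2 q : {poly L}, forall k, E q`_k & root q x && ~~ root q^`() x.

Lemma separable_over_sub E E' x :
  E `<=` E' -> separable_over E x -> separable_over E' x.
Proof. by move=> EE' [q qE qx]; exists q => // k; apply: EE'. Qed.

Lemma exp_XsubC_pchar c a : c \in [pchar L] ->
  ('X - a%:P) ^+ c = 'X^c - (a ^+ c)%:P :> {poly L}.
Proof.
move=> hc.
have hc' : c \in [pchar {poly L}].
  exact: (rmorph_pchar (polyC : {rmorphism L -> {poly L}})).
have := pFrobenius_autB_comm hc' (mulrC 'X a%:P).
by rewrite !pFrobenius_autE -polyC_exp.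
Qed.

Lemma expr_pchar_inj c x y : c \in [pchar L] -> x ^+ c = y ^+ c -> x = y.
Proof.
by move=> hc; rewrite -!(pFrobenius_autE hc); apply: fmorph_inj.
Qed.

Section Minpoly.
Variables (F : fieldType) (iota : {rmorphism F -> L}) (a : L) (p : {poly F}).
Hypothesis pmin : is_minpoly iota a p.

Lemma minpoly_deriv_root : p^`() != 0 -> ~~ root (map_poly iota p^`()) a.
Proof.
move=> dp; apply: (minpoly_small_neq0 pmin dp).
by apply: lt_size_deriv; apply: (minpoly_neq0 pmin).
Qed.

Lemma separable_overP : separable_over (range iota) a <-> p^`() != 0.
Proof.
have [_ rp _] := pmin; split=> [[q qF /andP[rq rdq]]|dp]; last first.
  exists (map_poly iota p); first by move=> k; rewrite coef_map; exists p`_k.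
  by rewrite rp deriv_map minpoly_deriv_root.
have [r rE] := poly_lift qF; move: rq rdq; rewrite -rE (minpoly_dvd pmin).
case/dvdpP => s ->; apply: contraNneq => dp.
rewrite rmorphM derivM /root !hornerE (rootP rp) mulr0 deriv_map dp.
by rewrite rmorph0 horner0 mulr0 addr0.
Qed.

(** A vanishing derivative leaves only exponents divisible by the characteristic c, so p is a
    polynomial in X^c. As [p1] is strictly smaller, this supports inductions on the size. *)
Lemma insep_minpoly : p^`() = 0 -> exists c p1, [/\ c \in [pchar L],
  p = p1 \Po 'X^c, is_minpoly iota (a ^+ c) p1 & (size p1 < size p)%N].
Proof.
move=> dp; have [pm rp min_p] := pmin; have sp := minpoly_size_gt1 pmin.
have coef0 k : p`_k *+ k = 0.
  case: k => [|k]; first by rewrite mulr0n.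
  by rewrite -coef_deriv dp coef0.
have [c hc] : exists c, c \in [pchar F].
  apply: (@natf0_pchar _ (size p).-1); first by rewrite -ltnS prednK // ltnW.
  by have := coef0 (size p).-1; rewrite -lead_coefE (monicP pm) => ->.
have c_gt1 : (1 < c)%N by apply/prime_gt1/(pcharf_prime hc).
have c_gt0 := ltnW c_gt1.
have [p1 pE] : exists p1, p = p1 \Po 'X^c.
  exists (\poly_(k < size p) p`_(k * c)); apply/polyP => k.
  rewrite coef_comp_poly_Xn // coef_poly; case: ifP => [ck|/negbT ck].
    rewrite divnK //; case: ltnP => // h; rewrite nth_default //.
    by apply: leq_trans h _; apply: leq_div.
  have /eqP := coef0 k.
  by rewrite -mulr_natr mulf_eq0 -(dvdn_pcharf hc) (negPf ck) orbF => /eqP.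
have sXc : (1 < size ('X^c : {poly F}))%N by rewrite size_polyXn ltnS.
have sp1 (q : {poly F}) : (size (q \Po 'X^c)).-1 = ((size q).-1 * c)%N.
  by rewrite size_comp_poly size_polyXn.
have rcomp q : root (map_poly iota (q \Po 'X^c)) a = root (map_poly iota q) (a ^+ c).
  by rewrite /root map_comp_poly /= map_polyXn horner_comp hornerXn.
have p1gt1 : (1 < size p1)%N.
  rewrite ltnNge; apply/negP => /size1_polyC h.
  by move: sp; rewrite pE h comp_polyC size_polyC; case: eqP.
have sp1E : ((size p1).-1 * c = (size p).-1)%N by rewrite -sp1 -pE.
exists c, p1; split=> //.
- by rewrite (fmorph_pchar iota).
- split.
  + have := pm; rewrite !monicE pE lead_coef_comp // lead_coefXn expr1n mulr1.
    exact.
  + by rewrite -rcomp -pE.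
  + move=> q qN0; rewrite -rcomp => rq.
    have := min_p _ _ rq; rewrite comp_poly_eq0 // => /(_ qN0) h.
    have := leq_sub2r 1 h; rewrite !subn1 sp1 -sp1E leq_pmul2r //.
    have := qN0; rewrite -size_poly_gt0.
    by case: (size q) => // k _; case: (size p1).
- move: sp1E p1gt1 sp; case: (size p1) => // k; case: (size p) => // l /= <-.
  by rewrite !ltnS => k0 _; rewrite ltn_Pmulr.
Qed.

End Minpoly.
End Separable.
Section SeparableClosed.
Variables (L : closedFieldType).
Variables (F : fieldType) (iota : {rmorphism F -> L}).

Lemma separable_minpoly_roots a p : is_minpoly iota a p ->
  separable_over (range iota) a ->
  exists rs, map_poly iota p = \prod_(b <- rs) ('X - b%:P) /\ uniq rs.
Proof.
move=> pmin /(separable_overP pmin) dp.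
have [rs rsE] := closed_field_poly_normal (map_poly iota p).
have [pm _ _] := pmin.
have lp : lead_coef (map_poly iota p) = 1 by apply/monicP; rewrite map_monic.
rewrite lp scale1r in rsE; exists rs; split=> //.
rewrite -separable_prod_XsubC -rsE separable_map unlock.
apply: (minpoly_coprime pmin); apply: contraL (minpoly_deriv_root pmin dp).
by rewrite (minpoly_dvd pmin) negbK.
Qed.

(** The roots of p are distinct and all equal to [a], so p is X - a, and [a] is minus its constant
    coefficient. *)
Lemma separable_purely_insep a p : is_minpoly iota a p ->
  separable_over (range iota) a ->
  (forall b, root (map_poly iota p) b -> b = a) -> range iota a.
Proof.
move=> pmin sa h; have [rs [rsE urs]] := separable_minpoly_roots pmin sa.
have rsa b : b \in rs -> b = a.
  by move=> brs; apply: h; rewrite rsE root_prod_XsubC.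
have ars : a \in rs by rewrite -root_prod_XsubC -rsE; case: pmin.
have rs1 : rs = [:: a].
  case: rs urs rsa ars {rsE} => [|b [|c s]] //= urs rsa _.
    by rewrite (rsa b) ?mem_head.
  by move: urs; rewrite (rsa b) ?mem_head // (rsa c) ?inE ?eqxx ?orbT.
exists (- p`_0) => //; have := congr1 (fun q : {poly L} => q`_0) rsE.
by rewrite rs1 big_seq1 coefB coefX coefC coef_map /= sub0r rmorphN => ->; rewrite opprK.
Qed.

(** Write b = q(y) with q of degree below that of y. At each conjugate e of y one has q(e)^c = b^c,
    hence q(e) = b by injectivity of Frobenius. So q - b has more roots than its degree allows, and
    b is the constant coefficient of q. *)
Lemma separable_radical_mem y b c : algebraicOver iota y ->
  separable_over (range iota) y -> c \in [pchar L] ->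
  adjoin (range iota) y b -> range iota (b ^+ c) -> range iota b.
Proof.
move=> algy sy hc; have [p pmin] := exists_minpoly algy.
have [rs [rsE urs]] := separable_minpoly_roots pmin sy.
move=> /(adjoin_poly pmin)[q sq bE] [d _ dE].
have rsb e : e \in rs -> (map_poly iota q).[e] = b.
  rewrite -root_prod_XsubC -rsE => re.
  have : root (map_poly iota (q ^+ c - d%:P)) e.
    rewrite (minpoly_root_transfer pmin _ re) rmorphB rmorphXn /= map_polyC.
    rewrite /root !hornerE.
    by rewrite -bE subr_eq0; apply/eqP; rewrite -dE.
  rewrite rmorphB rmorphXn /= map_polyC /root !hornerE subr_eq0 => /eqP h.
  exact: (expr_pchar_inj hc (etrans h dE)).
have : map_poly iota q - b%:P = 0.
  apply: (@roots_geq_poly_eq0 _ _ rs) => //.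
    by apply/allP => e ers; rewrite /root !hornerE rsb // subrr.
  have := congr1 (fun r : {poly L} => size r) rsE.
  rewrite size_prod_XsubC size_map_poly => sp.
  apply: leq_trans (size_polyD _ _) _.
  rewrite geq_max size_map_poly -ltnS -sp sq size_polyN size_polyC /=.
  have := minpoly_size_gt1 pmin; rewrite sp.
  by case: (b != 0); case: (size rs).
move/eqP; rewrite subr_eq0 => /eqP/(congr1 (fun r : {poly L} => r`_0)).
by rewrite coef_map coefC /= => <-; exists q`_0.
Qed.

End SeparableClosed.

(** * Root multiplicities of minimal polynomials *)

Lemma comp_poly_expr (R : comNzRingType) (p q : {poly R}) n :
  p ^+ n \Po q = (p \Po q) ^+ n.
Proof.
elim: n => [|n IH]; first by rewrite !expr0 -[1]/(1%:P) comp_polyC.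
by rewrite !exprS comp_polyM IH.
Qed.

Section Multiplicity.
Variable L : closedFieldType.

Lemma mup_comp_Xn_pchar c a (q : {poly L}) : c \in [pchar L] -> q != 0 ->
  mup a (q \Po 'X^c) = (c * mup (a ^+ c) q)%N.
Proof.
move=> hc qN0; have c0 : (0 < c)%N by apply/prime_gt0/(pcharf_prime hc).
have : ('X - (a ^+ c)%:P) ^+ mup (a ^+ c) q %| q by rewrite -mup_geq.
case/dvdpP => r qE; have rN0 : r != 0 by apply: contraNneq qN0 => r0; rewrite qE r0 mul0r.
have rr : ~~ root r (a ^+ c).
  apply/negP => /factor_theorem[r' r'E].
  have : ('X - (a ^+ c)%:P) ^+ (mup (a ^+ c) q).+1 %| q.
    by rewrite [X in _ %| X]qE r'E -mulrA -exprS; apply: dvdp_mull.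
  by rewrite -mup_geq // ltnn.
have e : q \Po 'X^c = (r \Po 'X^c) * ('X - a%:P) ^+ (c * mup (a ^+ c) q).
  rewrite {1}qE comp_polyM; congr (_ * _).
  rewrite exprM (exp_XsubC_pchar a hc) comp_poly_expr; congr (_ ^+ _).
  by rewrite comp_polyB comp_polyX comp_polyC.
rewrite e mupMr ?mup_XsubCX ?eqxx //.
by rewrite /root horner_comp hornerXn.
Qed.

Lemma mup_minpoly_separable (F : fieldType) (i : {rmorphism F -> L}) a p :
  is_minpoly i a p -> p^`() != 0 -> mup a (map_poly i p) = 1%N.
Proof.
move=> pmin dp; have p0 : map_poly i p != 0 by rewrite map_poly_eq0 (minpoly_neq0 pmin).
apply/eqP; rewrite eqn_leq -XsubC_dvd // dvdp_XsubCl; case: pmin (pmin) => _ -> _ pmin.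
rewrite andbT mup_leq //; apply: contra (minpoly_deriv_root pmin dp).
rewrite -deriv_map => /dvdpP[r ->]; rewrite expr2 !derivM derivXsubC.
by rewrite mul1r mulr1 /root !(hornerXsubC, hornerM, hornerD) subrr !(mulr0, addr0).
Qed.

(** If p1 is separable, its multiplicity at [a] is 1. Otherwise the hypothesis makes p2 inseparable
    too; both are then polynomials in X^c, both multiplicities acquire the factor c, and the
    comparison moves to a^c. *)
Lemma mup_minpoly_le (F1 F2 : fieldType) (i1 : {rmorphism F1 -> L})
    (i2 : {rmorphism F2 -> L}) :
  (forall y, separable_over (range i2) y -> separable_over (range i1) y) ->
  forall a p1 p2, is_minpoly i1 a p1 -> is_minpoly i2 a p2 ->
  (mup a (map_poly i1 p1) <= mup a (map_poly i2 p2))%N.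
Proof.
move=> sep21 a p1; have [n] := ubnP (size p1).
elim: n a p1 => // n IH a p1 sp1 p2 min1 min2.
have [dp1|dp1] := eqVneq p1^`() 0; last first.
  rewrite (mup_minpoly_separable min1 dp1) -XsubC_dvd.
    by rewrite dvdp_XsubCl; case: min2.
  by rewrite map_poly_eq0 (minpoly_neq0 min2).
have [dp2|dp2] := eqVneq p2^`() 0; last first.
  have := sep21 a; rewrite !separable_overP; [|exact: min1|exact: min2].
  by rewrite dp1 eqxx => /(_ dp2).
have [c [q1 [hc p1E qmin1 sq1]]] := insep_minpoly min1 dp1.
have [d [q2 [hd p2E qmin2 _]]] := insep_minpoly min2 dp2.
have dc : d = c by have := hd; rewrite (pcharf_eq hc) => /eqP.
rewrite p1E p2E dc !map_comp_poly /= !map_polyXn !mup_comp_Xn_pchar //.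
- rewrite leq_mul2l; apply/orP; right; apply: IH => //; last by rewrite -dc.
  exact: leq_trans sq1 _.
- by rewrite map_poly_eq0 (minpoly_neq0 qmin2).
- by rewrite map_poly_eq0 (minpoly_neq0 qmin1).
Qed.

End Multiplicity.

(** * The henselization inside the decomposition field *)

Section Henselization.
Variables (K : fieldType) (L : closedFieldType) (iota : {rmorphism K -> L}).
Hypothesis algK : forall x, algebraicOver iota x.
Variables (G : oagType) (v : valuation L G).
Local Notation Dfield := (decomposition_field iota v).

Lemma henselian_separable_mem (E : set L) x : range iota `<=` E ->
  henselian v E -> Dfield x -> separable_over E x -> E x.
Proof.
move=> KE hE Dx sx; have fE := subfield_field_set (proj1 hE).
have {}sx : separable_over (range (@subfield_val _ _ fE)) x by rewrite range_subfield_val.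
have [p pmin] := exists_minpoly (algebraic_over_subfield algK fE x KE).
suff : range (@subfield_val _ _ fE) x by rewrite range_subfield_val.
apply: (separable_purely_insep pmin sx) => b rb.
have [s Ds <-] := henselian_conj algK KE hE pmin rb.
by rewrite Dx.
Qed.

(** The characteristic exponent, equal to 1 in characteristic zero, so that its powers are always
    positive exponents. *)
Lemma exists_exp_char :
  exists2 c, (0 < c)%N & forall d, d \in [pchar L] -> d = c.
Proof.
have [[c hc]|noc] := pselect (exists c, c \in [pchar L]).
  exists c; first by apply/prime_gt0/(pcharf_prime hc).
  by move=> d; rewrite (pcharf_eq hc) => /eqP.
by exists 1%N => // d hd; case: noc; exists d.
Qed.

(** As long as x is inseparable over E, replacing it by x^c shrinks its minimal polynomial. A
    separable element is reached in fewer than n steps, and it lies in E. *)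
Lemma radical_mem c (E : set L) (fE : field_set E) n x p :
  (forall d, d \in [pchar L] -> d = c) ->
  (forall y, Dfield y -> separable_over E y -> E y) -> Dfield x ->
  is_minpoly (@subfield_val _ _ fE) x p -> (size p <= n)%N -> E (x ^+ (c ^ n)).
Proof.
move=> hc sepE; have sE : is_subfield E := proj1 fE.
elim: n x p => [|n IH] x p Dx pmin sp.
  by have := minpoly_size_gt1 pmin; case: (size p) sp.
have [dp|dp] := eqVneq p^`() 0.
  have [d [q [/hc -> _ qmin sq]]] := insep_minpoly pmin dp.
  rewrite expnS exprM; apply: (IH _ q) => //; last exact: leq_trans sq sp.
  exact: (subfieldX (decomposition_field_subfield _ _)).
apply: (subfieldX sE); apply: sepE => //.
by have := separable_overP pmin; rewrite range_subfield_val => ->.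
Qed.

(** The exponent comes from the minimal polynomial over K, whose size bounds that of the minimal
    polynomial over any E. This uniformity in E lets the power lie in the intersection of all such
    E. *)
Lemma exists_radical_exponent x : Dfield x -> exists2 n, (0 < n)%N &
  forall E, range iota `<=` E -> henselian v E -> E (x ^+ n).
Proof.
move=> Dx; have [c c0 hc] := exists_exp_char.
have [p [pm rp min_p]] := exists_minpoly (algK x).
exists (c ^ size p)%N; first by rewrite expn_gt0 c0.
move=> E KE hE; have fE := subfield_field_set (proj1 hE).
have [q qmin] := exists_minpoly (algebraic_over_subfield algK fE x KE).
apply: (radical_mem (fE := fE) (p := q)) => //.
  by move=> y; apply: henselian_separable_mem.
have [r rE] : exists r, map_poly (@subfield_val _ _ fE) r = map_poly iota p.
  apply: (poly_lift (iota := @subfield_val _ _ fE)) => k.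
  by rewrite range_subfield_val coef_map; apply: KE; exists p`_k.
rewrite -(size_map_poly iota p) -rE size_map_poly.
case: qmin => _ _; apply; last by rewrite rE.
by rewrite -(map_poly_eq0 (@subfield_val _ _ fE)) rE map_poly_eq0 monic_neq0.
Qed.

Local Notation Khens := (henselization v (range iota)).

Lemma henselization_subfield (F : set L) : is_subfield (henselization v F).
Proof. by apply: subfield_smallest => E []. Qed.

Lemma henselization_henselian : henselian v Khens.
Proof.
apply: (henselian_radical algK (henselization_subfield _)) => x Dx.
have [n n0 hn] := exists_radical_exponent Dx.
by exists n => // E [hE KE]; apply: hn.
Qed.

Lemma sub_henselization (F : set L) : F `<=` henselization v F.
Proof. exact: sub_gen_smallest. Qed.

Lemma henselization_sub_decomposition : Khens `<=` Dfield.
Proof.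
apply: smallest_sub; last exact: sub_decomposition_field.
apply: (henselian_radical algK (decomposition_field_subfield _ _)) => x Dx.
by exists 1%N; rewrite ?expr1.
Qed.

(** An extension of a henselian field is henselian, since a valuation extending v from the larger
    field also extends it from the smaller one. *)
Lemma henselization_adjoin a :
  henselization v (adjoin (range iota) a) = adjoin Khens a.
Proof.
have [_ hH] := henselization_henselian.
apply/seteqP; split.
  apply: smallest_sub.
    split=> [|G' w wval wv]; first exact: adjoin_subfield.
    by apply: hH => // x y Hx Hy; apply: wv; apply: sub_adjoin.
  apply: adjoin_sub; [exact: adjoin_subfield| |exact: mem_adjoin].
  by apply: subset_trans (@sub_adjoin _ _ _); apply: sub_henselization.
apply: adjoin_sub; first exact: henselization_subfield.
  move=> x Hx E [hE KaE]; apply: Hx; split=> //.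
  by apply: subset_trans KaE; apply: sub_adjoin.
exact: (@sub_henselization (adjoin (range iota) a) a (@mem_adjoin _ (range iota) a)).
Qed.

End Henselization.
Lemma subfield_bigcup (L : fieldType) (C : set (set L)) :
  C !=set0 -> (forall E, C E -> is_subfield E) -> total_on C subset ->
  is_subfield (\bigcup_(E in C) E).
Proof.
move=> C0 sC totC; apply: proj1 (field_set_bigcup C0 _ totC) => E CE.
exact: subfield_field_set (sC _ CE).
Qed.

Lemma adjoin_bigcup (L : fieldType) (C : set (set L)) (b : L) :
  C !=set0 -> total_on C subset ->
  adjoin (\bigcup_(E in C) E) b `<=` \bigcup_(E in C) adjoin E b.
Proof.
move=> [E0 CE0] totC.
have -> : \bigcup_(E in C) adjoin E b = \bigcup_(M in [set adjoin E b | E in C]) M.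
  by rewrite bigcup_image.
apply: adjoin_sub.
- apply: subfield_bigcup; first by exists (adjoin E0 b), E0.
    by move=> _ [E _ <-]; apply: adjoin_subfield.
  move=> _ _ [E CE <-] [E' CE' <-].
  by have [EE|EE] := totC _ _ CE CE'; [left|right];
    apply: adjoin_sub; rewrite /=; [apply: adjoin_subfield|
      apply: subset_trans EE _; apply: sub_adjoin|apply: mem_adjoin|
      apply: adjoin_subfield|
      apply: subset_trans EE _; apply: sub_adjoin|apply: mem_adjoin].
- move=> x [E CE Ex]; exists (adjoin E b); first by exists E.
  exact: sub_adjoin.
- by exists (adjoin E0 b); [exists E0|apply: mem_adjoin].
Qed.

Section SeparableHenselization.
Variables (K : fieldType) (L : closedFieldType) (iota : {rmorphism K -> L}).
Hypothesis algK : forall x, algebraicOver iota x.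
Variables (G : oagType) (v : valuation L G).
Local Notation Dfield := (decomposition_field iota v).

(* Otherwise [a] lies outside K(a^c), c being the characteristic. A field E
   between K and the decomposition field which is maximal for [a] to lie outside
   E(a^c) is henselian, hence contains the henselization. *)
Lemma separable_over_henselization a :
  separable_over (henselization v (range iota)) a ->
  separable_over (range iota) a.
Proof.
move=> sHa; have [p pmin] := exists_minpoly (algK a).
apply/(separable_overP pmin); apply/eqP => dp.
have [c [p1 [hc pE p1min _]]] := insep_minpoly pmin dp.
have c_gt1 : (1 < c)%N by apply/prime_gt1/(pcharf_prime hc).
pose Q (E : set L) := [/\ is_subfield E, E `<=` Dfield & ~ adjoin E (a ^+ c) a].
have QK : Q (range iota).
  split; [exact: subfield_range|exact: sub_decomposition_field|].
  move=> /(adjoin_poly p1min)[q sq aE].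
  have : root (map_poly iota (q \Po 'X^c - 'X)) a.
    rewrite rmorphB /= map_comp_poly /= map_polyXn map_polyX /root !hornerE.
    by rewrite horner_comp hornerXn -aE subrr.
  (* As c > 1, the coefficient of X is -1. A non-zero polynomial vanishing at [a] with degree below
     that of p then contradicts minimality. *)
  have qN0 : q \Po 'X^c - 'X != 0.
    apply/eqP => /(congr1 (fun r : {poly K} => r`_1)).
    rewrite coefB coef_comp_poly_Xn ?(ltnW c_gt1) // coefX dvdn1 gtn_eqF // coef0 sub0r.
    by move/eqP; rewrite oppr_eq0 oner_eq0.
  move=> r0; have [_ _ /(_ _ qN0 r0)] := pmin.
  have sXc : (size ('X^c : {poly K})).-1 = c by rewrite size_polyXn.
  have sp : (size p).-1 = ((size p1).-1 * c)%N by rewrite pE size_comp_poly sXc.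
  have sp1 := minpoly_size_gt1 p1min.
  have sp' := minpoly_size_gt1 pmin.
  apply/negP; rewrite -ltnNge; apply: leq_ltn_trans (size_polyD _ _) _.
  rewrite size_polyN size_polyX gtn_max; apply/andP; split.
    rewrite -(prednK (ltnW sp')) ltnS sp.
    have := size_comp_poly q 'X^c; rewrite sXc => sqc.
    have q1 : ((size q).-1 * c < (size p1).-1 * c)%N.
      rewrite ltn_pmul2r ?(ltnW c_gt1) //; move: sq sp1.
      by case: (size q) => [|k]; case: (size p1) => [|l] //=.
    by apply: leq_trans (leqSpred _) _; rewrite sqc.
  rewrite -(prednK (ltnW sp')) ltnS sp.
  move: sp1; case: (size p1) => [|[|l]] //= _.
  by rewrite mulSn; apply: leq_trans c_gt1 (leq_addr _ _).
have [|E [KE [sE ED aE] maxE]] := Zorn_above QK.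
  move=> C C0 CQ totC; split.
  - by apply: subfield_bigcup => // E /CQ[].
  - by move=> x [E /CQ[_ ED _] Ex]; apply: ED.
  - by move=> /(adjoin_bigcup C0 totC)[E /CQ[_ _ h]].
have fE := subfield_field_set sE.
have algE x := algebraic_over_subfield algK fE x KE.
pose E1 := adjoin E (a ^+ c).
have sE1 : is_subfield E1 by apply: adjoin_subfield.
have EE1 : E `<=` E1 by apply: sub_adjoin.
have fE1 := subfield_field_set sE1.
have algE1 x := algebraic_over_subfield algK fE1 x (subset_trans KE EE1).
have E1ac : E1 (a ^+ c) by apply: mem_adjoin.
have rE1 := range_subfield_val fE1.
(* By maximality it suffices that E(y) satisfies Q. If [a] were in E(y)(a^c), it would lie in E1(y)
   with y separable over E1 and a^c in E1, so already in E1. *)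
have sepE y : Dfield y -> separable_over E y -> E y.
  move=> Dy sy; have sEy : is_subfield (adjoin E y) by apply: adjoin_subfield.
  apply: (maxE (adjoin E y)); [exact: sub_adjoin| |exact: mem_adjoin].
  split=> //; first by apply: adjoin_sub => //; apply: decomposition_field_subfield.
  move=> ha; apply: aE; rewrite -/E1 -rE1.
  apply: (separable_radical_mem (c := c) (algE1 y)) => //.
  - by rewrite rE1; apply: separable_over_sub sy.
  - rewrite rE1; apply: adjoin_sub ha; first exact: adjoin_subfield.
      apply: adjoin_sub; [exact: adjoin_subfield| |exact: mem_adjoin].
      exact: subset_trans (@sub_adjoin _ _ _).
    exact: sub_adjoin.
  - by rewrite rE1.
have hE : henselian v E.
  apply: (henselian_radical algK sE) => x Dx.
  have [d d0 hd] := exists_exp_char L; have [q qmin] := exists_minpoly (algE x).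
  exists (d ^ size q)%N; first by rewrite expn_gt0 d0.
  exact: (radical_mem hd sepE Dx qmin (leqnn _)).
(* Being henselian over K, E contains the henselization, so [a] is separable over E1; but X^c - a^c
   has [a] as its only root. *)
apply: aE; rewrite -/E1 -rE1; have [q qmin] := exists_minpoly (algE1 a).
apply: (separable_purely_insep qmin).
  rewrite rE1; apply: separable_over_sub sHa; apply: subset_trans EE1.
  by apply: smallest_sub.
move=> b rb.
have [y ye] : exists y : subfieldType fE1, subfield_val y = a ^+ c.
  have : range (@subfield_val _ _ fE1) (a ^+ c) by rewrite rE1.
  by case=> y _ ye; exists y.
have : root (map_poly (@subfield_val _ _ fE1) ('X^c - y%:P)) b.
  rewrite (minpoly_root_transfer qmin _ rb) rmorphB /= map_polyXn map_polyC.
  rewrite /root !hornerE /=.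
  by rewrite ye subrr.
rewrite rmorphB /= map_polyXn map_polyC /root !hornerE /= ye subr_eq0 => /eqP.
exact: expr_pchar_inj.
Qed.

End SeparableHenselization.
(** * Distinguished pairs *)

Section Products.
Variables (L : fieldType) (G : oagType) (v : valuation L G).

Lemma val_prod_le (I : eqType) (r : seq I) (f g : I -> L) :
  (forall i, i \in r -> v (f i) <= v (g i)) ->
  v (\prod_(i <- r) f i) <= v (\prod_(i <- r) g i).
Proof.
elim: r => [|i r IH] h; first by rewrite !big_nil.
rewrite !big_cons; apply: (le_trans (y := v (g i * \prod_(j <- r) f j))).
  by apply: val_mulr_le; apply: h; rewrite mem_head.
rewrite ![g i * _]mulrC; apply/val_mulr_le/IH => j jr.
by apply: h; rewrite inE jr orbT.
Qed.

Lemma vmax_unit_prod (I : eqType) (r : seq I) (f : I -> L) :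
  (forall i, i \in r -> vmax v (f i - 1)) -> vmax v (\prod_(i <- r) f i - 1).
Proof.
elim: r => [|i r IH] h; first by rewrite big_nil subrr vmax0.
rewrite big_cons; apply: vmax_unitM; first by apply: h; rewrite mem_head.
by apply: IH => j jr; apply: h; rewrite inE jr orbT.
Qed.

End Products.

Section Pairs.
Variables (K : fieldType) (L : closedFieldType) (iota : {rmorphism K -> L}).
Hypothesis algK : forall x, algebraicOver iota x.
Variables (G : oagType) (v : valuation L G).

Lemma degE a p : is_minpoly iota a p -> deg iota a = (size p).-1.
Proof. exact: degree_adjoin. Qed.

Lemma deg_root_lt a p (f : {poly K}) c : is_minpoly iota a p -> f != 0 ->
  (size f < size p)%N -> root (map_poly iota f) c -> (deg iota c < deg iota a)%N.
Proof.
move=> pmin fN0 sf rc; have [q qmin] := exists_minpoly (algK c).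
rewrite (degE pmin) (degE qmin); have [_ _ /(_ _ fN0 rc) h] := qmin.
have := minpoly_size_gt1 qmin; have := leq_ltn_trans h sf.
by case: (size q) => [|[|k]] //; case: (size p).
Qed.

Variables (theta alpha : L) (phi : {poly K}).
Hypothesis phi_min : is_minpoly iota alpha phi.
Hypothesis near_min : forall eta, (deg iota eta < deg iota alpha)%N ->
  v (theta - eta) < v (theta - alpha).

(** For each root c of f, (y - c) / (x - c) = 1 + (y - x) / (x - c), where v(x - c) = v(theta - c) <
    v(theta - alpha) <= v(y - x). *)
Lemma ratio_near (f : {poly K}) x y : f != 0 -> (size f < size phi)%N ->
  v (theta - alpha) <= v (theta - x) -> v (theta - alpha) <= v (theta - y) ->
  (map_poly iota f).[x] != 0 /\
  vmax v ((map_poly iota f).[y] / (map_poly iota f).[x] - 1).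
Proof.
move=> fN0 sf hx hy.
have [rs rsE] := closed_field_poly_normal (map_poly iota f).
have l0 : lead_coef (map_poly iota f) != 0 by rewrite lead_coef_eq0 map_poly_eq0.
have hc c : c \in rs -> v (x - c) = v (theta - c) /\ v (theta - c) < v (theta - alpha).
  rewrite -root_prod_XsubC -(rootZ _ _ l0) -rsE => rc.
  have lt_c := near_min (deg_root_lt phi_min fN0 sf rc); split=> //.
  have -> : x - c = (theta - c) + (x - theta) by ring.
  by rewrite val_lt_sum // (valB v x) (lt_le_trans lt_c).
have xc c : c \in rs -> x - c != 0.
  by move=> /hc[e1 e2]; rewrite -(val_lt0 v) e1 (lt_le_trans e2) ?val_le0.
rewrite {1}rsE hornerZ horner_prod; split.
  rewrite mulf_neq0 // prodf_seq_neq0; apply/allP => c crs /=.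
  by rewrite hornerXsubC xc.
rewrite rsE !hornerZ !horner_prod invfM mulrACA divff // mul1r -prodf_div /=.
apply: vmax_unit_prod => c crs; rewrite !hornerXsubC.
have -> : (y - c) / (x - c) - 1 = (y - x) / (x - c) by field; apply: xc.
rewrite -val_lt_div ?xc //; have [-> lt_c] := hc c crs.
have -> : y - x = (y - theta) + (theta - x) by ring.
apply: lt_le_trans lt_c _; apply: le_trans (Defs.valD v _ _).
by rewrite le_min (valB v y) hx hy.
Qed.

Lemma val_near (f : {poly K}) x y : f != 0 -> (size f < size phi)%N ->
  v (theta - alpha) <= v (theta - x) -> v (theta - alpha) <= v (theta - y) ->
  v (map_poly iota f).[x] = v (map_poly iota f).[y].
Proof. by move=> fN0 sf hx hy; have [_ /vmax_unit_val] := ratio_near fN0 sf hx hy. Qed.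

Lemma value_group_near beta : v (theta - alpha) <= v (theta - beta) ->
  value_group v (simple_ext iota alpha) `<=` value_group v (simple_ext iota beta).
Proof.
move=> hb g [x /(adjoin_poly phi_min)[f sf ->] vg].
have [f0|fN0] := eqVneq f 0; first by rewrite f0 rmorph0 horner0 val0 in vg.
exists (map_poly iota f).[beta]; first exact: adjoin_horner.
by rewrite -vg; apply: val_near.
Qed.

Lemma residue_subfield_near beta : v (theta - alpha) <= v (theta - beta) ->
  residue_subfield v (simple_ext iota alpha) `<=`
  residue_subfield v (simple_ext iota beta).
Proof.
move=> hb r [x /(adjoin_poly phi_min)[f sf xE] <-].
pose y := (map_poly iota f).[beta].
have Ey : simple_ext iota beta y by apply: adjoin_horner.
have [f0|fN0] := eqVneq f 0.
  have v0 : val (0 : valring v) = 0 by exact: rmorph0.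
  exists (0 : valring v).
    by rewrite /mkset v0; apply: (subfield0 (adjoin_subfield _ _)).
  congr residue; apply: val_inj; rewrite v0.
  by rewrite [RHS]xE f0 rmorph0 horner0.
have [x0 hxy] := ratio_near fN0 sf (lexx _) hb.
have vx : vring v (val x) := valringP x.
have vy : valring_pred v y.
  by rewrite /valring_pred -(val_near fN0 sf (lexx _) hb) -xE.
exists (ValRing vy) => //; apply/eqP; rewrite -subr_eq0 -rmorphB residue_eq0.
rewrite rmorphB /= xE -[v _]/(v _) -/(vmax v _).
have -> : y - (map_poly iota f).[alpha] =
    (y / (map_poly iota f).[alpha] - 1) * (map_poly iota f).[alpha].
  by rewrite mulrBl divfK // mul1r.
by apply: vmaxM => //; rewrite -xE.
Qed.

End Pairs.

(** * Counting roots in a ball by reduction *)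

Section Reduction.
Variables (L : fieldType) (G : oagType) (v : valuation L G).

Lemma prod_XsubC_comp (rs : seq L) (t d : L) :
  (forall c, c \in rs -> t != c) ->
  (\prod_(c <- rs) ('X - c%:P)) \Po (t%:P + d *: 'X) =
  (\prod_(c <- rs) ('X - c%:P)).[t] *: \prod_(c <- rs) (1 + (d / (t - c)) *: 'X).
Proof.
elim: rs => [|c rs IH] h; first by rewrite !big_nil hornerC scale1r comp_polyC.
rewrite !big_cons comp_polyM IH => [|b brs]; last by apply: h; rewrite inE brs orbT.
have -> : ('X - c%:P) \Po (t%:P + d *: 'X) = (t - c) *: (1 + (d / (t - c)) *: 'X).
  have tc : t - c != 0 by rewrite subr_eq0 h ?mem_head.
  rewrite comp_polyB comp_polyX comp_polyC scalerDr scalerA mulrCA divff // mulr1.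
  by rewrite alg_polyC polyCB addrAC.
by rewrite hornerM hornerXsubC -scalerAl -scalerAr scalerA.
Qed.

Lemma size_prod_1addZX (F : fieldType) (I : eqType) (r : seq I) (a : I -> F) :
  size (\prod_(i <- r) (1 + a i *: 'X)) = (count (fun i => a i != 0) r).+1.
Proof.
have s1 i : size (1 + a i *: 'X) = (a i != 0).+1.
  have [->|ai] := eqVneq (a i) 0; first by rewrite scale0r addr0 size_poly1.
  by rewrite addrC size_polyDl size_scale ?size_polyX // size_poly1.
elim: r => [|i r IH]; first by rewrite big_nil size_poly1.
rewrite big_cons size_mul ?s1 -?size_poly_eq0 ?s1 ?IH //=.
by rewrite ?addSn ?addnS.
Qed.

(** The default 0 is harmless: [lift] is only evaluated at integral elements. *)
Local Notation lift x := (insubd (0 : valring v) x).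

Definition valring_incl (x : valring v) : L := val x.

HB.instance Definition _ := GRing.RMorphism.copy valring_incl
  (val : {rmorphism valring v -> L}).

Lemma liftK x : vring v x -> valring_incl (lift x) = x.
Proof. by move=> vx; rewrite /valring_incl insubdK. Qed.

Lemma residue_lift_eq0 x : vring v x -> (residue (lift x) == 0) = vmax v x.
Proof. by move=> vx; rewrite residue_eq0 -[val _]/(valring_incl _) liftK. Qed.

Lemma map_lift_prod (I : eqType) (r : seq I) (a : I -> L) :
  (forall i, i \in r -> vring v (a i)) ->
  map_poly valring_incl (\prod_(i <- r) (1 + lift (a i) *: 'X)) =
  \prod_(i <- r) (1 + a i *: 'X).
Proof.
move=> va; rewrite rmorph_prod /= big_seq [RHS]big_seq; apply: eq_bigr => i ir.
by rewrite rmorphD rmorph1 /= map_polyZ map_polyX /= liftK ?va.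
Qed.

Lemma map_residue_prod (I : Type) (r : seq I) (a : I -> valring v) :
  map_poly (@residue _ _ v) (\prod_(i <- r) (1 + a i *: 'X)) =
  \prod_(i <- r) (1 + residue (a i) *: 'X).
Proof.
rewrite rmorph_prod /=; apply: eq_bigr => i _.
by rewrite rmorphD rmorph1 /= map_polyZ map_polyX.
Qed.

(* Substituting [t + d X] and reducing modulo the maximal ideal, each side
   becomes a polynomial whose degree is the number of roots at distance at least
   [v d] from [t]; by hypothesis the two differ by a constant. *)
Lemma count_ball_eq (rs rs' gs : seq L) (l t d : L) :
  let P := \prod_(c <- rs) ('X - c%:P) in
  let Q := \prod_(c <- rs') ('X - c%:P) in
  let R := l *: \prod_(c <- gs) ('X - c%:P) in
  P = Q + R -> d != 0 ->
  (forall c, c \in rs -> t != c /\ v (t - c) <= v d) ->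
  (forall c, c \in rs' -> t != c /\ v (t - c) <= v d) ->
  (forall c, c \in gs -> v (t - c) < v d) ->
  v P.[t] = v Q.[t] -> v P.[t] <= v R.[t] ->
  has (fun c => v d <= v (t - c)) rs -> has (fun c => v d <= v (t - c)) rs' ->
  count (fun c => v d <= v (t - c)) rs = count (fun c => v d <= v (t - c)) rs'.
Proof.
move=> P Q R PQR d0 hrs hrs' hgs vPQ vPR has_rs has_rs'.
have tc (s : seq L) : (forall c, c \in s -> t != c /\ v (t - c) <= v d) ->
    forall c, c \in s -> t != c by move=> h c /h[].
have hgs' c : c \in gs -> t != c /\ v (t - c) <= v d.
  move=> /hgs lt_c; split; last exact: ltW.
  by rewrite -subr_eq0 -(val_lt0 v) (lt_le_trans lt_c) ?val_le0.
have vu (s : seq L) : (forall c, c \in s -> t != c /\ v (t - c) <= v d) ->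
    forall c, c \in s -> vring v (d / (t - c)).
  by move=> h c /h[c0]; rewrite val_le_div // subr_eq0.
have Pt0 : P.[t] != 0.
  rewrite horner_prod prodf_seq_neq0; apply/allP => c /(tc rs hrs).
  by rewrite /= hornerXsubC subr_eq0.
have Qt0 : Q.[t] != 0 by rewrite -(val_lt0 v) -vPQ val_lt0.
(* Dividing by P(t) makes the constant term of the P side 1. The value hypotheses say that a is a
   unit, so the Q side keeps its degree under reduction, and that b is integral. *)
pose a := Q.[t] / P.[t]; pose b := R.[t] / P.[t].
have va : vring v a by rewrite -val_le_div // vPQ.
have vb : vring v b by rewrite -val_le_div.
have ua : ~~ vmax v a by rewrite -val_lt_div // vPQ ltxx.
pose D s := \prod_(c <- s) (1 + (d / (t - c)) *: 'X).
pose DV s := \prod_(c <- s) (1 + lift (d / (t - c)) *: 'X).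
have eL : D rs = a *: D rs' + b *: D gs.
  have := congr1 (fun q => q \Po (t%:P + d *: 'X)) PQR.
  rewrite comp_polyD comp_polyZ !prod_XsubC_comp; [|exact: tc..].
  move/(congr1 (fun q => P.[t]^-1 *: q)).
  rewrite scalerA mulVf // scale1r scalerDr !scalerA {1}/D => ->.
  by rewrite [_ * Q.[t]]mulrC -mulrA [_^-1 * _]mulrC /b /R hornerZ.
have eV : DV rs = lift a *: DV rs' + lift b *: DV gs.
  apply: (map_inj_poly (f := valring_incl) val_inj (rmorph0 _)).
  rewrite rmorphD /= !map_polyZ !map_lift_prod; [|exact: vu..].
  by rewrite /= !liftK.
have := congr1 (fun q => size (map_poly (@residue _ _ v) q)) eV.
rewrite rmorphD /= !map_polyZ !map_residue_prod.
(* The roots of R lie at distance exceeding the radius, so every coefficient d / (t - c) reduces to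
   0 and the R term to a constant. *)
rewrite [X in _ + _ *: X]big_seq [X in _ + _ *: X]big1 => [|c cgs]; last first.
  suff /eqP -> : residue (lift (d / (t - c))) == 0 by rewrite scale0r addr0.
  by rewrite residue_lift_eq0 ?(vu gs hgs') // -val_lt_div ?hgs // subr_eq0 (tc gs hgs').
have cnt (s : seq L) : (forall c, c \in s -> t != c /\ v (t - c) <= v d) ->
    count (fun c => residue (lift (d / (t - c))) != 0) s =
    count (fun c => v d <= v (t - c)) s.
  move=> h; apply: eq_in_count => c cs /=.
  by rewrite residue_lift_eq0 ?(vu s h) // -val_lt_div ?subr_eq0 ?(tc s h) // -leNgt.
have s2 : size (residue (lift a) *:
      \prod_(c <- rs') (1 + residue (lift (d / (t - c))) *: 'X)) =
    (count (fun c => v d <= v (t - c)) rs').+1.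
  by rewrite size_scale ?residue_lift_eq0 // size_prod_1addZX cnt.
rewrite size_polyDl s2 ?size_prod_1addZX ?cnt //; first by case.
(* The constant does not affect the degree, as [rs'] has an element in the ball and the reduced Q
   side is not constant. *)
apply: leq_ltn_trans (size_scale_leq _ _) _.
by rewrite size_poly1 ltnS -has_count.
Qed.

End Reduction.
(** Removing the class of the head of s1 from both sequences removes equally many entries and leaves
    the counts of the other classes unchanged. *)
Lemma size_eq_class_counts (T : eqType) (e : rel T) (s1 s2 : seq T) :
  equivalence_rel e ->
  (forall x, x \in s1 ++ s2 -> count (e x) s1 = count (e x) s2) ->
  size s1 = size s2.
Proof.
move=> eqe; have [n] := ubnP (size s1).
have ee x : e x x by have [] := eqe x x x.
have eLR x y : e x y -> e x =1 e y by move=> xy z; have [_ ->] := eqe x y z.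
elim: n s1 s2 => // n IH s1 s2 ss h.
case: s1 ss h => [|x s1] ss h.
  by case: s2 h => // x s2 /(_ x); rewrite /= mem_head ee => /(_ isT).
have hx : count (e x) (x :: s1) = count (e x) s2 by apply: h; rewrite mem_head.
have sizeE s : size s = (count (e x) s + size (filter (predC (e x)) s))%N.
  by rewrite size_filter count_predC.
rewrite (sizeE (x :: s1)) (sizeE s2) hx; congr (_ + _)%N; apply: IH.
  rewrite /= ee /=; apply: leq_ltn_trans (_ : (size s1 < n)%N) => //.
  by rewrite size_filter count_size.
move=> y; rewrite -filter_cat mem_filter => /andP[/= xy yin].
have cnt s : count (e y) (filter (predC (e x)) s) = count (e y) s.
  rewrite count_filter; apply: eq_count => z /=.
  have [yz|//] := boolP (e y z); rewrite /=; apply: contra xy => xz.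
  by rewrite (eLR x z xz) -(eLR y z yz).
by have := h y yin; rewrite -(cnt (x :: s1)) -(cnt s2).
Qed.

(** * Values of the two minimal polynomials at theta *)

Section DistinguishedPairs.
Variables (K : fieldType) (L : closedFieldType) (iota : {rmorphism K -> L}).
Hypothesis algK : forall x, algebraicOver iota x.
Variables (G : oagType) (v : valuation L G) (theta : L).
Implicit Types (alpha beta : L) (phi psi : {poly K}).

Lemma distinguished_pair_dist alpha beta :
  distinguished_pair iota v theta alpha -> distinguished_pair iota v theta beta ->
  v (theta - alpha) = v (theta - beta).
Proof.
move=> [da [_ ubA] _] [db [_ ubB] _]; apply: le_anti; apply/andP; split.
  by apply: ubB; exists alpha.
by apply: ubA; exists beta.
Qed.

Lemma distinguished_pair_deg alpha beta :
  distinguished_pair iota v theta alpha -> distinguished_pair iota v theta beta ->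
  deg iota alpha = deg iota beta.
Proof.
move=> dA dB; have e := distinguished_pair_dist dA dB.
have [_ _ hA] := dA; have [_ _ hB] := dB.
case: (ltngtP (deg iota alpha) (deg iota beta)) => //.
  by move=> /hB; rewrite e ltxx.
by move=> /hA; rewrite e ltxx.
Qed.

Lemma distinguished_pair_max alpha c : distinguished_pair iota v theta alpha ->
  (deg iota c < deg iota theta)%N -> v (theta - c) <= v (theta - alpha).
Proof. by move=> [_ [_ ub] _] dc; apply: ub; exists c. Qed.

Section TwoPairs.
Variables (alpha beta : L) (phi psi : {poly K}).
Hypotheses (dA : distinguished_pair iota v theta alpha)
  (dB : distinguished_pair iota v theta beta).
Hypotheses (phi_min : is_minpoly iota alpha phi)
  (psi_min : is_minpoly iota beta psi).

Let near_min eta : (deg iota eta < deg iota alpha)%N ->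
  v (theta - eta) < v (theta - alpha).
Proof. by case: dA => _ _; apply. Qed.

Lemma distinguished_minpoly_size : size phi = size psi.
Proof.
have := distinguished_pair_deg dA dB; rewrite (degE phi_min) (degE psi_min).
have := minpoly_size_gt1 phi_min; have := minpoly_size_gt1 psi_min.
by case: (size phi) => // k; case: (size psi) => // l _ _ /= ->.
Qed.

Lemma size_minpolyB : (size (phi - psi)%R < size phi)%N.
Proof.
have [pm _ _] := phi_min; have [qm _ _] := psi_min.
have sp := minpoly_size_gt1 phi_min; have spq := distinguished_minpoly_size.
rewrite -(prednK (ltnW sp)) ltnS; apply/leq_sizeP => k.
rewrite leq_eqVlt => /orP[/eqP <-|kp]; rewrite coefB.
  by rewrite {2}spq -!lead_coefE (monicP pm) (monicP qm) subrr.
by rewrite !nth_default ?subrr // -?spq -(prednK (ltnW sp)).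
Qed.

(** Conjugates of alpha have its degree, which is below that of theta, so they compete in the
    maximum defining the pair. *)
Lemma minpoly_root_near c : root (map_poly iota phi) c ->
  theta != c /\ v (theta - c) <= v (theta - alpha).
Proof.
move=> rc; have dc : deg iota c = deg iota alpha.
  by rewrite (degE phi_min) (degE (minpoly_of_root phi_min rc)).
have [lt_d _ _] := dA.
have lt_c : (deg iota c < deg iota theta)%N by rewrite dc.
split; last exact: distinguished_pair_max.
by apply: contraTneq lt_c => ->; rewrite ltnn.
Qed.

Lemma minpoly_diff_near : phi != psi ->
  v (map_poly iota (phi - psi)).[theta] = v (map_poly iota psi).[alpha].
Proof.
move=> neq; have rA : root (map_poly iota phi) alpha by case: phi_min.
have -> : v (map_poly iota psi).[alpha] = v (map_poly iota (phi - psi)).[alpha].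
  by rewrite rmorphB !hornerE (rootP rA) sub0r Defs.valN.
apply: (val_near algK phi_min near_min); rewrite ?subr_eq0 ?size_minpolyB //.
by rewrite subrr val_le0.
Qed.

End TwoPairs.

(** Holds root by root: v(theta - c) <= v(theta - alpha) for each root c of psi, hence v(alpha - c)
    >= v(theta - c). As phi - psi takes the value -psi(alpha) at alpha, this bounds (phi -
    psi)(theta). *)
Lemma val_minpoly_near alpha beta phi psi :
  distinguished_pair iota v theta alpha -> distinguished_pair iota v theta beta ->
  is_minpoly iota alpha phi -> is_minpoly iota beta psi ->
  v (map_poly iota psi).[theta] <= v (map_poly iota psi).[alpha].
Proof.
move=> dA dB phi_min psi_min.
have [rs rsE] := closed_field_poly_normal (map_poly iota psi).
have [pm _ _] := psi_min.
have lp : lead_coef (map_poly iota psi) = 1 by apply/monicP; rewrite map_monic.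
rewrite rsE lp scale1r !horner_prod; apply: val_prod_le => c crs.
have rc : root (map_poly iota psi) c by rewrite rsE lp scale1r root_prod_XsubC.
have [_ vc] := minpoly_root_near dB psi_min rc; rewrite !hornerXsubC.
have -> : alpha - c = (theta - c) + (alpha - theta) by ring.
apply: le_trans (Defs.valD v _ _); rewrite le_min lexx (valB v alpha).
by rewrite (distinguished_pair_dist dA dB).
Qed.

Lemma val_minpoly_le alpha beta phi psi :
  distinguished_pair iota v theta alpha -> distinguished_pair iota v theta beta ->
  is_minpoly iota alpha phi -> is_minpoly iota beta psi ->
  v (map_poly iota psi).[theta] <= v (map_poly iota phi).[theta].
Proof.
move=> dA dB phi_min psi_min; have [-> //|neq] := eqVneq phi psi.
have -> : map_poly iota phi = map_poly iota psi + map_poly iota (phi - psi).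
  by rewrite rmorphB addrC subrK.
rewrite hornerD; apply: le_trans (Defs.valD v _ _); rewrite le_min lexx /=.
rewrite (minpoly_diff_near dA dB phi_min psi_min neq).
exact: val_minpoly_near dA dB phi_min psi_min.
Qed.

Lemma val_minpoly_eq alpha beta phi psi :
  distinguished_pair iota v theta alpha -> distinguished_pair iota v theta beta ->
  is_minpoly iota alpha phi -> is_minpoly iota beta psi ->
  v (map_poly iota phi).[theta] = v (map_poly iota psi).[theta].
Proof.
move=> dA dB phi_min psi_min; apply: le_anti; apply/andP; split.
  exact: val_minpoly_le dB dA psi_min phi_min.
exact: val_minpoly_le dA dB phi_min psi_min.
Qed.

End DistinguishedPairs.

(** * Roots near theta over K and over the henselization *)

Section Counting.
Variables (K : fieldType) (L : closedFieldType) (iota : {rmorphism K -> L}).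
Hypothesis algK : forall x, algebraicOver iota x.
Variables (G : oagType) (v : valuation L G) (theta alpha beta : L).
Variables (phi psi : {poly K}).
Hypotheses (dA : distinguished_pair iota v theta alpha)
  (dB : distinguished_pair iota v theta beta).
Hypotheses (phi_min : is_minpoly iota alpha phi)
  (psi_min : is_minpoly iota beta psi).

Lemma monic_closed_roots (F : fieldType) (i : {rmorphism F -> L}) a p :
  is_minpoly i a p ->
  exists rs, map_poly i p = \prod_(c <- rs) ('X - c%:P).
Proof.
case=> pm _ _; have [rs rsE] := closed_field_poly_normal (map_poly i p).
have lp : lead_coef (map_poly i p) = 1 by apply/monicP; rewrite map_monic.
by exists rs; rewrite rsE lp scale1r.
Qed.

Lemma count_near_minpoly (rs rs' : seq L) :
  map_poly iota phi = \prod_(c <- rs) ('X - c%:P) ->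
  map_poly iota psi = \prod_(c <- rs') ('X - c%:P) ->
  count (fun c => v (theta - alpha) <= v (theta - c)) rs =
  count (fun c => v (theta - alpha) <= v (theta - c)) rs'.
Proof.
move=> rsE rsE'; have e := distinguished_pair_dist dA dB.
have [eqpp|neq] := eqVneq phi psi.
  by apply/permP/prod_XsubC_eq; rewrite -rsE -rsE' eqpp.
have [gs gsE] := closed_field_poly_normal (map_poly iota (phi - psi)).
have l0 : lead_coef (map_poly iota (phi - psi)) != 0.
  by rewrite lead_coef_eq0 map_poly_eq0 subr_eq0.
have near_min : forall eta, (deg iota eta < deg iota alpha)%N ->
  v (theta - eta) < v (theta - alpha) by case: dA.
have rP c : (c \in rs) = root (map_poly iota phi) c by rewrite rsE root_prod_XsubC.
have rP' c : (c \in rs') = root (map_poly iota psi) c by rewrite rsE' root_prod_XsubC.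
have dE : v (theta - alpha) = v (alpha - theta) by apply: valB.
(* The scaling element d is alpha - theta, whose value is the radius. *)
rewrite dE; apply: (count_ball_eq (gs := gs) (l := lead_coef (map_poly iota (phi - psi)))).
- by rewrite -rsE -rsE' -gsE rmorphB addrC subrK.
- rewrite subr_eq0; case: dA => lt_d _ _.
  by apply: contraTneq lt_d => ->; rewrite ltnn.
- by move=> c; rewrite rP -dE; apply: (minpoly_root_near dA phi_min).
- by move=> c; rewrite rP' -dE e; apply: (minpoly_root_near dB psi_min).
- move=> c; rewrite -root_prod_XsubC -(rootZ _ _ l0) -gsE -dE => rc.
  apply: near_min; apply: (deg_root_lt algK phi_min _ _ rc).
    by rewrite subr_eq0.
  exact: (size_minpolyB dA dB phi_min psi_min).
- by rewrite -rsE -rsE'; apply: (val_minpoly_eq algK dA dB phi_min psi_min).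
- rewrite -rsE -gsE (minpoly_diff_near algK dA dB phi_min psi_min neq).
  rewrite (val_minpoly_eq algK dA dB phi_min psi_min).
  exact: (val_minpoly_near dA dB phi_min psi_min).
- apply/hasP; exists alpha; last by rewrite -dE.
  by rewrite rP; case: phi_min.
- apply/hasP; exists beta; last by rewrite -dE e.
  by rewrite rP'; case: psi_min.
Qed.

Local Notation Khens := (henselization v (range iota)).

(* Sending [alpha] to a conjugate in the ball preserves the valuation of
   K(alpha), so it extends to an element of the decomposition group. *)
Lemma near_root_conj x : root (map_poly iota phi) x ->
  v (theta - alpha) <= v (theta - x) ->
  exists2 s, decomposition iota v s & s alpha = x.
Proof.
move=> rx hx.
have near_min : forall eta, (deg iota eta < deg iota alpha)%N ->
  v (theta - eta) < v (theta - alpha) by case: dA.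
have [|s [sK sa sv]] := @hom_extension_adjoin _ _ _ _ _ algK _ _ v v _ _ _ phi_min rx.
  move=> q.
  have red y : root (map_poly iota phi) y ->
      (map_poly iota q).[y] = (map_poly iota (q %% phi)).[y].
    move=> ry; rewrite {1}(divp_eq q phi) rmorphD rmorphM hornerD hornerM.
    by rewrite (rootP ry) mulr0 add0r.
  have ra : root (map_poly iota phi) alpha by case: phi_min.
  rewrite !red //; have [->|qN0] := eqVneq (q %% phi) 0.
    by rewrite rmorph0 !horner0.
  rewrite /vring (val_near algK phi_min near_min qN0 _ (lexx _) hx) //.
  by rewrite ltn_modp (minpoly_neq0 phi_min).
by exists s.
Qed.

Section Conjugates.
Variables (fH : field_set Khens) (p : {poly subfieldType fH}).
Hypothesis p_min : is_minpoly (@subfield_val _ _ fH) alpha p.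

Lemma decomposition_henselization_root s (q : {poly subfieldType fH}) c :
  decomposition iota v s ->
  root (map_poly (@subfield_val _ _ fH) q) c ->
  root (map_poly (@subfield_val _ _ fH) q) (s c).
Proof.
move=> Ds; have -> : root (map_poly (@subfield_val _ _ fH) q) (s c) =
    root (map_poly s (map_poly (@subfield_val _ _ fH) q)) (s c).
  rewrite -map_poly_comp; congr (root _ _); apply: eq_map_poly => k /=.
  by rewrite (henselization_sub_decomposition algK (mem_subfield_val k)).
by rewrite fmorph_root.
Qed.

(** Multiplicities are compared at each x of the ball. One inequality is p | phi; for the other,
    [near_root_conj] makes a root x of phi a root of p, and [mup_minpoly_le] applies because
    separability descends from the henselization to K. *)
Lemma count_near_henselization (ps rs : seq L) :
  map_poly (@subfield_val _ _ fH) p = \prod_(c <- ps) ('X - c%:P) ->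
  map_poly iota phi = \prod_(c <- rs) ('X - c%:P) ->
  count (fun c => v (theta - alpha) <= v (theta - c)) ps =
  count (fun c => v (theta - alpha) <= v (theta - c)) rs.
Proof.
move=> psE rsE; set b := fun c => _.
suff /permP/(_ predT) : perm_eq (filter b ps) (filter b rs).
  by rewrite !count_predT !size_filter.
have KH : range iota `<=` Khens by apply: sub_henselization.
have [r rE] : exists r, map_poly (@subfield_val _ _ fH) r = map_poly iota phi.
  apply: (poly_lift (iota := @subfield_val _ _ fH)) => k.
  by rewrite range_subfield_val coef_map; apply: KH; exists phi`_k.
have p_dvd : map_poly (@subfield_val _ _ fH) p %| map_poly iota phi.
  by rewrite -rE dvdp_map -(minpoly_dvd p_min) rE; case: phi_min.
have phi0 : map_poly iota phi != 0 by rewrite map_poly_eq0 (minpoly_neq0 phi_min).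
have p0 : map_poly (@subfield_val _ _ fH) p != 0.
  by rewrite map_poly_eq0 (minpoly_neq0 p_min).
apply/allP => x _ /=; rewrite !count_filter.
have cnt s : count (predI (pred1 x) b) s = if b x then count_mem x s else 0%N.
  case: ifP => bx; last rewrite -(count_pred0 s); apply: eq_count => y /=.
    by case: eqP => [->|]; rewrite ?bx.
  by case: eqP => [->|]; rewrite ?bx.
rewrite !cnt; case: ifP => // bx; rewrite -!mu_prod_XsubC -psE -rsE.
have [rx|rx] := boolP (root (map_poly iota phi) x); last first.
  rewrite !mupNroot //; apply: contra rx; rewrite -!dvdp_XsubCl => h.
  exact: dvdp_trans h p_dvd.
rewrite eqn_leq; apply/andP; split.
  by rewrite mup_geq //; apply: dvdp_trans p_dvd; rewrite -mup_geq.
have [s Ds sx] := near_root_conj rx bx.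
have px : root (map_poly (@subfield_val _ _ fH) p) x.
  by rewrite -sx; apply: decomposition_henselization_root => //; case: p_min.
apply: (mup_minpoly_le _ (minpoly_of_root phi_min rx) (minpoly_of_root p_min px)).
move=> y; rewrite range_subfield_val; exact: separable_over_henselization.
Qed.

Lemma decomposition_perm_roots s (ps : seq L) : decomposition iota v s ->
  map_poly (@subfield_val _ _ fH) p = \prod_(c <- ps) ('X - c%:P) ->
  perm_eq (map s ps) ps.
Proof.
move=> Ds psE; apply: prod_XsubC_eq; rewrite big_map -psE.
have -> : \prod_(c <- ps) ('X - (s c)%:P) = map_poly s (\prod_(c <- ps) ('X - c%:P)).
  by rewrite map_prod_XsubC.
rewrite -psE -map_poly_comp; apply: eq_map_poly => k /=.
exact: (henselization_sub_decomposition algK (mem_subfield_val k)).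
Qed.

Lemma count_near_conj s (ps : seq L) (g : with_oo G) x : decomposition iota v s ->
  map_poly (@subfield_val _ _ fH) p = \prod_(c <- ps) ('X - c%:P) ->
  count (fun c => g <= v (s x - c)) ps = count (fun c => g <= v (x - c)) ps.
Proof.
move=> Ds psE; have /permP <- := decomposition_perm_roots Ds psE.
rewrite count_map; apply: eq_count => c /=.
by rewrite -rmorphB (decomposition_val algK _ Ds).
Qed.

End Conjugates.
End Counting.
Section HenselizationDegree.
Variables (K : fieldType) (L : closedFieldType) (iota : {rmorphism K -> L}).
Hypothesis algK : forall x, algebraicOver iota x.
Variables (G : oagType) (v : valuation L G) (theta alpha beta : L).
Hypotheses (dA : distinguished_pair iota v theta alpha)
  (dB : distinguished_pair iota v theta beta).
Local Notation Khens := (henselization v (range iota)).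

(* The roots of the minimal polynomials over the henselization are grouped
   into balls of radius v(theta - alpha). The decomposition group permutes the
   balls, so both polynomials have equally many roots in each of them. *)
Lemma degree_henselization_eq :
  degree Khens (henselization v (simple_ext iota alpha)) =
  degree Khens (henselization v (simple_ext iota beta)).
Proof.
rewrite !henselization_adjoin //.
have fH := subfield_field_set (henselization_subfield v (range iota)).
have KH : range iota `<=` Khens by apply: sub_henselization.
have hH : henselian v Khens by apply: henselization_henselian.
have algH x := algebraic_over_subfield algK fH x KH.
have [p p_min] := exists_minpoly (algH alpha).
have [q q_min] := exists_minpoly (algH beta).
have := degree_adjoin p_min; have := degree_adjoin q_min.
rewrite range_subfield_val => -> ->; congr _.-1.
have [ps psE] := monic_closed_roots p_min; have [qs qsE] := monic_closed_roots q_min.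
rewrite -(size_map_poly (@subfield_val _ _ fH) p).
rewrite -(size_map_poly (@subfield_val _ _ fH) q).
rewrite psE qsE !size_prod_XsubC; congr _.+1.
have [phi phi_min] := exists_minpoly (algK alpha).
have [psi psi_min] := exists_minpoly (algK beta).
have [rs rsE] := monic_closed_roots phi_min.
have [rs' rsE'] := monic_closed_roots psi_min.
have e := distinguished_pair_dist dA dB.
have near_trans x y z : v (theta - alpha) <= v (x - y) ->
    (v (theta - alpha) <= v (x - z)) = (v (theta - alpha) <= v (y - z)).
  move=> xy; apply/idP/idP => h.
    have -> : y - z = (y - x) + (x - z) by ring.
    by apply: le_trans (Defs.valD v _ _); rewrite le_min (valB v y) xy.
  have -> : x - z = (x - y) + (y - z) by ring.
  by apply: le_trans (Defs.valD v _ _); rewrite le_min xy.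
have ball_count : count (fun c => v (theta - alpha) <= v (theta - c)) ps =
    count (fun c => v (theta - alpha) <= v (theta - c)) qs.
  rewrite (count_near_henselization algK dA phi_min p_min psE rsE).
  rewrite (count_near_minpoly algK dA dB phi_min psi_min rsE rsE') e.
  by rewrite -(count_near_henselization algK dB psi_min q_min qsE rsE').
pose near : rel L := fun x y => v (theta - alpha) <= v (x - y).
have ball_center c : v (theta - alpha) <= v (theta - c) ->
    count (near c) ps = count (near c) qs.
  move=> hc.
  rewrite -[RHS](_ : count (fun d => v (theta - alpha) <= v (theta - d)) qs = _).
    by rewrite -ball_count; apply: eq_count => d; rewrite /near (near_trans _ _ _ hc).
  by apply: eq_count => d; rewrite /near (near_trans _ _ _ hc).
have conj_count s c : decomposition iota v s ->
    v (theta - alpha) <= v (theta - c) ->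
    count (near (s c)) ps = count (near (s c)) qs.
  move=> Ds hc; rewrite /near (count_near_conj algK _ c Ds psE).
  by rewrite (count_near_conj algK _ c Ds qsE); apply: ball_center.
apply: (size_eq_class_counts (e := near)).
  move=> x y z; split; first by rewrite /near subrr val_le0.
  by move=> xy; apply: near_trans.
(* Each root of p is s alpha and each root of q is s beta for some s in the decomposition group,
   with alpha and beta in the ball around theta. *)
move=> x; rewrite mem_cat => /orP[].
  rewrite -root_prod_XsubC -psE => rx.
  have [s Ds <-] := henselian_conj algK KH hH p_min rx.
  by apply: conj_count.
rewrite -root_prod_XsubC -qsE => rx.
have [s Ds <-] := henselian_conj algK KH hH q_min rx.
by apply: conj_count; rewrite // e.
Qed.

End HenselizationDegree.

Theorem theorem5p14 (K : fieldType) (Kbar : closedFieldType)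
    (iota : {rmorphism K -> Kbar})
    (Kbar_algebraic : forall x : Kbar, algebraicOver iota x)
    (G : oagType) (v : valuation K G) (vbar : valuation Kbar G)
    (vbar_extends : forall x : K, vbar (iota x) = v x)
    (theta alpha beta : Kbar) (phi psi : {poly K})
    (theta_alpha : distinguished_pair iota vbar theta alpha)
    (theta_beta : distinguished_pair iota vbar theta beta)
    (theta_unibranched :
      unibranched vbar (range iota) (simple_ext iota theta))
    (phi_min : is_minpoly iota alpha phi)
    (psi_min : is_minpoly iota beta psi) :
  [/\ value_group vbar (simple_ext iota alpha)
        = value_group vbar (simple_ext iota beta),
      residue_subfield vbar (simple_ext iota alpha)
        = residue_subfield vbar (simple_ext iota beta),
      vbar (map_poly iota phi).[theta] = vbar (map_poly iota psi).[theta]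
    & defect vbar (range iota) (simple_ext iota alpha)
        = defect vbar (range iota) (simple_ext iota beta)].
Proof.
have dist := distinguished_pair_dist theta_alpha theta_beta.
have near_alpha eta : (deg iota eta < deg iota alpha)%N ->
    vbar (theta - eta) < vbar (theta - alpha) by case: theta_alpha => _ _; apply.
have near_beta eta : (deg iota eta < deg iota beta)%N ->
    vbar (theta - eta) < vbar (theta - beta) by case: theta_beta => _ _; apply.
have le_ab : vbar (theta - alpha) <= vbar (theta - beta) by rewrite dist.
have le_ba : vbar (theta - beta) <= vbar (theta - alpha) by rewrite dist.
have eqG : value_group vbar (simple_ext iota alpha)
    = value_group vbar (simple_ext iota beta).
  apply/seteqP; split.
    exact: (value_group_near Kbar_algebraic phi_min near_alpha le_ab).
  exact: (value_group_near Kbar_algebraic psi_min near_beta le_ba).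
have eqk : residue_subfield vbar (simple_ext iota alpha)
    = residue_subfield vbar (simple_ext iota beta).
  apply/seteqP; split.
    exact: (residue_subfield_near Kbar_algebraic phi_min near_alpha le_ab).
  exact: (residue_subfield_near Kbar_algebraic psi_min near_beta le_ba).
split=> //.
  exact: (val_minpoly_eq Kbar_algebraic theta_alpha theta_beta phi_min psi_min).
(* The denominators are functions of the value group and residue field, so only the degrees over the
   henselization remain. *)
rewrite /defect /ramification_index /inertia_degree eqG eqk.
by rewrite (degree_henselization_eq Kbar_algebraic theta_alpha theta_beta).
Qed.
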